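(* Under the joint action of the transvector algebra $Z(\mathfrak{g},\mathfrak{s})$ and the group $\mathrm{SO}(m)$, the space of double harmonics decomposes as $$\mathcal{P}(\mathbb{R}^{2m},\mathbb{C})\cap\ker(\Delta_x,\Delta_u)\;\cong\;\bigoplus_{k\ge l\ge 0}\mathbb{V}[k,l]\otimes\mathcal{H}_{k,l}(\mathbb{R}^{2m},\mathbb{C}),$$ the sum running over all pairs of integers $(k,l)$ with $k\ge l\ge 0$. Concretely, for each such $(k,l)$ the map $\mathbb{V}[k,l]\otimes\mathcal{H}_{k,l}\to\mathcal{P}(\mathbb{R}^{2m},\mathbb{C})\cap\ker(\Delta_x,\Delta_u)$, $\Phi(C)S_u^j 1_{[k,l]}\otimes H'\mapsto \Phi(C)S_u^jH'$ (with $\Phi$ a polynomial and $1_{[k,l]}$ the highest weight vector of $\mathbb{V}[k,l]$, corresponding to $H$), is an injective $Z(\mathfrak{g},\mathfrak{s})\times\mathrm{SO}(m)$-intertwining map, and the images of these maps together give the whole space as a direct sum.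
   Context: Fix an integer $m>4$. For $x,u\in\mathbb{R}^m$ let $\mathcal{P}(\mathbb{R}^{2m},\mathbb{C})$ be the complex polynomials in $(x,u)$ and $\mathcal{P}_{p,q}$ those homogeneous of degree $p$ in $x$ and $q$ in $u$. Write $|x|^2=\sum x_j^2$, $\langle u,x\rangle=\sum u_jx_j$, $\Delta_x=\sum\partial_{x_j}^2$, $\Delta_u=\sum\partial_{u_j}^2$, $\langle\partial_u,\partial_x\rangle=\sum\partial_{u_j}\partial_{x_j}$, $\langle x,\partial_u\rangle=\sum x_j\partial_{u_j}$, $\langle u,\partial_x\rangle=\sum u_j\partial_{x_j}$, $\mathbb{E}_x=\sum x_j\partial_{x_j}$, $\mathbb{E}_u=\sum u_j\partial_{u_j}$, and $\ker(D_1,\dots,D_r)=\bigcap\ker D_i$. Every $P\in\mathcal{P}_{p,q}$ can be written uniquely as $P=\sum_{a,b\ge0}|x|^{2a}|u|^{2b}H'_{p-2a,q-2b}$ with $H'_{p-2a,q-2b}\in\mathcal{P}_{p-2a,q-2b}\cap\ker(\Delta_x,\Delta_u)$; let $\pi_{\mathfrak{s}}$ be the linear operator with $\pi_{\mathfrak{s}}P=H'_{p,q}$ (the composition of the extremal projection operators of the two harmonic copies of $\mathfrak{sl}(2)$). On $\ker(\Delta_x,\Delta_u)$ define $S_x=\pi_{\mathfrak{s}}\langle x,\partial_u\rangle$, $S_u=\pi_{\mathfrak{s}}\langle u,\partial_x\rangle$, $A=\pi_{\mathfrak{s}}\langle\partial_u,\partial_x\rangle$, $C=\pi_{\mathfrak{s}}\langle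 u,x\rangle$. The transvector algebra $Z(\mathfrak{g},\mathfrak{s})$ (of the pair $\mathfrak{g}=\mathfrak{sp}(4)$, $\mathfrak{s}=\mathfrak{sl}(2)_x\oplus\mathfrak{sl}(2)_u$) acts on $\ker(\Delta_x,\Delta_u)$ and is generated (with coefficients rational in $\mathbb{E}_x,\mathbb{E}_u$) by $S_x,S_u,A,C$. $\mathrm{SO}(m)$ acts by $(g\cdot P)(x,u)=P(g^{-1}x,g^{-1}u)$. For $k\ge l\ge0$ the simplicial harmonics are $\mathcal{H}_{k,l}=\mathcal{P}_{k,l}\cap\ker(\Delta_x,\Delta_u,\langle\partial_u,\partial_x\rangle,\langle x,\partial_u\rangle)$ (a model of the irreducible $\mathrm{SO}(m)$-module of highest weight $(k,l,0,\dots,0)$). For fixed nonzero $H\in\mathcal{H}_{k,l}$, the $Z(\mathfrak{g},\mathfrak{s})$-module $\mathbb{V}[k,l]$ is realised as $\bigoplus_{i\ge0}\bigoplus_{j=0}^{k-l}\mathrm{Span}(C^iS_u^jH)$, with highest weight vector $H$. *)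

(* Defs.v *)
From Stdlib Require Import Reals ClassicalEpsilon.
From HB Require Import structures.
From mathcomp Require Import all_boot all_algebra.
From mathcomp Require Import Rstruct complex mpoly.

Set Implicit Arguments.
Unset Strict Implicit.
Unset Printing Implicit Defensive.

Import GRing.Theory Num.Theory.
Local Open Scope ring_scope.

Definition RR : rcfType := Rdefinitions.R.
Definition CC := (RR[i])%C.

(* complex polynomials in (x,u) in R^m x R^m : variables 'I_(m+m),
   x_j = variable (lshift m j), u_j = variable (rshift m j) *)
Definition Pol (m : nat) := {mpoly CC[m + m]}.

Section DoubleHarmonics.
Variable m : nat.
Local Notation P := (Pol m).

Definition xv (j : 'I_m) : P := 'X_(lshift m j).
Definition uv (j : 'I_m) : P := 'X_(rshift m j).
Definition dx (j : 'I_m) (p : P) : P := mderiv (lshift m j) p.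
Definition du (j : 'I_m) (p : P) : P := mderiv (rshift m j) p.

Definition bihomog (p q : nat) (f : P) : Prop :=
  forall mo : 'X_{1..m + m}, mo \in msupp f ->
    (\sum_(j < m) mo (lshift m j))%N = p /\ (\sum_(j < m) mo (rshift m j))%N = q.

Definition normx2 : P := \sum_(j < m) xv j ^+ 2.
Definition normu2 : P := \sum_(j < m) uv j ^+ 2.
Definition ux : P := \sum_(j < m) uv j * xv j.

Definition Lap_x (f : P) : P := \sum_(j < m) dx j (dx j f).
Definition Lap_u (f : P) : P := \sum_(j < m) du j (du j f).
Definition Dux (f : P) : P := \sum_(j < m) du j (dx j f).
Definition Xdu (f : P) : P := \sum_(j < m) xv j * du j f.
Definition Udx (f : P) : P := \sum_(j < m) uv j * dx j f.
Definition Eulx (f : P) : P := \sum_(j < m) xv j * dx j f.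
Definition Eulu (f : P) : P := \sum_(j < m) uv j * du j f.

Definition dharm (f : P) : Prop := Lap_x f = 0 /\ Lap_u f = 0.

Definition simpharm (k l : nat) (f : P) : Prop :=
  bihomog k l f /\ dharm f /\ Dux f = 0 /\ Xdu f = 0.

Definition sdecomp (f h : P) : Prop :=
  exists (N : nat) (G : nat -> nat -> P),
    (0 < N)%N /\ (forall a b, dharm (G a b)) /\ G 0%N 0%N = h /\
    f = \sum_(a < N) \sum_(b < N) normx2 ^+ a * normu2 ^+ b * G a b.

(* pi_s f := the component H'_{0,0} of the above (unique) decomposition *)
Definition pis (f : P) : P := epsilon (inhabits 0) (fun h => sdecomp f h).

Definition Sx (f : P) : P := pis (Xdu f).
Definition Su (f : P) : P := pis (Udx f).
Definition Aop (f : P) : P := pis (Dux f).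
Definition Cop (f : P) : P := pis (ux * f).

Definition SOm (g : 'M[RR]_m) : Prop := g^T *m g = 1%:M /\ \det g = 1.

Definition SOact (g : 'M[RR]_m) (f : P) : P :=
  let gi := invmx g in
  comp_mpoly
    [tuple (match split i with
            | inl j => \sum_(k < m) ((gi j k)%:C)%C *: xv k
            | inr j => \sum_(k < m) ((gi j k)%:C)%C *: uv k
            end) | i < m + m] f.

Definition CS (i j : nat) (f : P) : P := iter i Cop (iter j Su f).

End DoubleHarmonics.

(* Main.v *)
(** For the Fischer inner product, multiplication by a coordinate is adjoint to
    the corresponding derivative, so [pi_s] is the orthogonal projection along
    the ideal [I] generated by [|x|^2] and [|u|^2], and two double harmonics
    that agree modulo [I] are equal.  Computing modulo [I] gives explicit
    formulas for [S_x], [S_u], [A], [C] on polynomials of given degrees and the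
    relations that push [S_u] and [A] through [C].  With [a_p = 1/(m+2p-2)] in
    degree [(p, q)],
      [S_u C = (1 - 2 a_p) C S_u],  [S_x C = (1 - 2 a_q) C S_x],
      [A C = m + p + q + (1 - 4 a_p a_q) C A - 2 a_p S_x S_u - 2 a_q S_u S_x].
    On [C^i S_u^j H] every generator then acts by a universal scalar, and the
    coefficient of [A] has a closed form that does not vanish, so [A] undoes
    [C].  Since [C] is adjoint to [A] and [S_u] to [S_x], distinct vectors
    [C^i S_u^j H] are orthogonal and nonzero.  They span by induction on the
    degree: lift [A f] through [C] to reduce to [ker A], where [S_x] and [S_u]
    are the raising and lowering operators of an [sl(2)] of adjoint operators. *)

Require Import Defs.
From Stdlib Require Import ClassicalEpsilon.
From HB Require Import structures.
From mathcomp Require Import all_boot all_order all_algebra.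
From mathcomp Require Import Rstruct complex ssrcomplements mpoly ring zify.
Import Order.TTheory GRing.Theory Num.Theory.
Local Open Scope ring_scope.

Set Implicit Arguments.
Unset Strict Implicit.
Unset Printing Implicit Defensive.

(** * The Fischer inner product *)

Section FischerProduct.
Variable n : nat.
Implicit Types (f g h : {mpoly CC[n]}) (mo : 'X_{1..n}).

Definition mfact mo : nat := \prod_(i < n) (mo i)`!.

(** This is f(d) applied to the coefficientwise conjugate of g and evaluated at 0, written on
    monomials, which are orthogonal with squared norms [mfact mo]. It is linear in f and antilinear
    in g. *)
Definition fischer f g : CC :=
  \sum_(mo <- msupp f) f@_mo * ((mfact mo)%:R * (g@_mo)^*).

(** Replaces the support of f by an index set that several polynomials can share, so that their sums
    can be combined termwise. *)
Lemma fischerE d f g : (msize f <= d)%N ->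
  fischer f g = \sum_(mo : 'X_{1..n < d}) f@_mo * ((mfact mo)%:R * (g@_mo)^*).
Proof.
move=> le_d; rewrite /fischer (big_mksub ('X_{1..n < d} : subFinType _)) ?msupp_uniq //=;
  last first.
  by move=> mo /msize_mdeg_lt lt_mo; apply: leq_trans lt_mo _.
rewrite big_rmcond //= => mo /memN_msupp_eq0 ->.
by rewrite mul0r.
Qed.

Lemma fischer_is_linear g : scalar (fischer^~ g).
Proof.
move=> c f h; set d := maxn (msize (c *: f + h)) (maxn (msize f) (msize h)).
rewrite (@fischerE d) ?leq_maxl // (@fischerE d f) 1?(@fischerE d h); first last.
- by rewrite /d !leq_max leqnn !orbT.
- by rewrite /d !leq_max leqnn !orbT.
rewrite mulr_sumr -big_split /=; apply: eq_bigr => mo _.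
by rewrite mcoeffD mcoeffZ mulrDl !mulrA.
Qed.

Lemma fischer_conj f g : fischer g f = (fischer f g)^*.
Proof.
set d := maxn (msize f) (msize g).
rewrite (@fischerE d) ?leq_maxr // (@fischerE d f) ?leq_maxl //.
rewrite rmorph_sum /=; apply: eq_bigr => mo _.
by rewrite !rmorphM /= conjCK conjC_nat; ring.
Qed.

Lemma fischerDl f g h : fischer (f + g) h = fischer f h + fischer g h.
Proof. by rewrite -[f]scale1r fischer_is_linear mul1r scale1r. Qed.

Lemma fischer0l g : fischer 0 g = 0.
Proof. by rewrite /fischer msupp0 big_nil. Qed.

Lemma fischerZl c f g : fischer (c *: f) g = c * fischer f g.
Proof. by rewrite -[c *: f]addr0 fischer_is_linear fischer0l addr0. Qed.

Lemma fischer0r g : fischer g 0 = 0.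
Proof. by rewrite fischer_conj fischer0l rmorph0. Qed.

Lemma fischer_suml I r (P : pred I) (F : I -> {mpoly CC[n]}) g :
  fischer (\sum_(i <- r | P i) F i) g = \sum_(i <- r | P i) fischer (F i) g.
Proof. exact: (big_morph (fischer^~ g) (fun f h => fischerDl f h g) (fischer0l g)). Qed.

Lemma fischerCr c f g : fischer f (c%:MP * g) = c^* * fischer f g.
Proof. by rewrite fischer_conj mul_mpolyC fischerZl rmorphM /= -fischer_conj. Qed.

Lemma fischer_sumr I r (P : pred I) (F : I -> {mpoly CC[n]}) g :
  fischer g (\sum_(i <- r | P i) F i) = \sum_(i <- r | P i) fischer g (F i).
Proof.
rewrite fischer_conj fischer_suml rmorph_sum.
by apply: eq_bigr => i _; rewrite /= -fischer_conj.
Qed.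

Lemma fischer_ge0 f : 0 <= fischer f f.
Proof.
rewrite /fischer sumr_ge0 // => mo _.
by rewrite mulrCA mulr_ge0 ?ler0n // mul_conjC_ge0.
Qed.

Lemma fischer_eq0 f : fischer f f = 0 -> f = 0.
Proof.
have term_ge0 mo : 0 <= f@_mo * ((mfact mo)%:R * (f@_mo)^*).
  by rewrite mulrCA mulr_ge0 ?ler0n // mul_conjC_ge0.
move/eqP; rewrite psumr_eq0 // => /allP f0; apply/mpolyP => mo; rewrite mcoeff0.
have [/f0 /=|/memN_msupp_eq0 //] := boolP (mo \in msupp f).
rewrite !mulf_eq0 pnatr_eq0 conjC_eq0 orbCA orbb; case/orP => [|/eqP //].
by rewrite -leqn0 leqNgt prodn_gt0 // => i; rewrite fact_gt0.
Qed.

Lemma mfactD mo i : mfact (mo + U_(i)) = ((mo i).+1 * mfact mo)%N.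
Proof.
rewrite /mfact (bigD1 i) // [in RHS](bigD1 i) //= mnmDE mnm1E eqxx addn1 factS -mulnA.
congr (_ * (_ * _))%N; apply: eq_bigr => j ne_ji.
by rewrite mnmDE mnm1E eq_sym (negPf ne_ji) addn0.
Qed.

Lemma fischerXl mo g : fischer 'X_[mo] g = (mfact mo)%:R * (g@_mo)^*.
Proof. by rewrite /fischer msuppX big_seq1 mcoeffX eqxx mul1r. Qed.

(** By linearity f may be a monomial; then the factor gained by the factorial weight is the one that
    the derivative produces. *)
Lemma fischer_mulX i f g : fischer ('X_i * f) g = fischer f (mderiv i g).
Proof.
rewrite [f]mpolyE mulr_sumr !fischer_suml; apply: eq_bigr => mo _.
rewrite -scalerAr !fischerZl -mpolyXD addmC !fischerXl mcoeff_mderiv mfactD.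
by rewrite rmorphMn natrM /= -[_ *+ (mo i).+1]mulr_natl; congr (_ * _); ring.
Qed.

Lemma fischer_deriv i f g : fischer (mderiv i f) g = fischer f ('X_i * g).
Proof. by rewrite fischer_conj -fischer_mulX -fischer_conj. Qed.

End FischerProduct.

(** * Commutation relations of the scalar products of x, u, d_x, d_u *)

(* The flag [true] stands for the vector [x], [false] for [u]. *)
Definition idx m (s : bool) (j : 'I_m) : 'I_(m + m) :=
  if s then lshift m j else rshift m j.
Definition var m s (j : 'I_m) : Pol m := 'X_(idx s j).
Definition pd m s (j : 'I_m) (f : Pol m) : Pol m := mderiv (idx s j) f.

(* The scalar products of the vectors (v) and of the gradients (d) are locked:
   otherwise conversion checks between polynomial expressions unfold them down
   to coefficients. *)
HB.lock Definition dotvv m s t : Pol m := \sum_(j < m) var s j * var t j.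
HB.lock Definition dotvd m s t f : Pol m := \sum_(j < m) var s j * pd t j f.
HB.lock Definition dotdd m s t f : Pol m := \sum_(j < m) pd s j (pd t j f).

Section Operators.
Variable m : nat.
Local Notation P := (Pol m).
Local Notation M := (@dotvv m).
Local Notation X := (@dotvd m).
Local Notation D := (@dotdd m).
Implicit Types (s t a b c d : bool) (j k : 'I_m) (f g h : P).

Lemma dotvvE s t : M s t = \sum_(j < m) var s j * var t j.
Proof. by rewrite unlock. Qed.

Lemma dotvdE s t f : X s t f = \sum_(j < m) var s j * pd t j f.
Proof. by rewrite unlock. Qed.

Lemma dotddE s t f : D s t f = \sum_(j < m) pd s j (pd t j f).
Proof. by rewrite unlock. Qed.

Lemma idx_eq s j t k : (idx s j == idx t k) = (s == t) && (j == k).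
Proof.
case: s t => [] [] /=; rewrite ?eq_lshift ?eq_rshift ?eq_lrshift ?eq_rlshift //.
Qed.

Lemma pd_is_linear s j : linear (pd s j).
Proof. exact: mderiv_is_linear. Qed.

HB.instance Definition _ s j :=
  GRing.isLinear.Build CC P P *:%R (pd s j) (pd_is_linear s j).

Lemma pdD s j f g : pd s j (f + g) = pd s j f + pd s j g.
Proof. exact: mderivD. Qed.

Lemma pdZ s j (c : CC) f : pd s j (c *: f) = c *: pd s j f.
Proof. exact: mderivZ. Qed.

Lemma pdMn s j f (q : nat) : pd s j (f *+ q) = pd s j f *+ q.
Proof. exact: mderivMn. Qed.

Lemma pdM s j f g : pd s j (f * g) = pd s j f * g + f * pd s j g.
Proof. exact: mderivM. Qed.

Lemma pdC s j t k f : pd s j (pd t k f) = pd t k (pd s j f).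
Proof. exact: mderiv_comm. Qed.

Lemma pd_var s j t k : pd s j (var t k) = ((s == t) && (j == k))%:R.
Proof.
rewrite /pd /var mderivX mnm1E idx_eq [in LHS]eq_sym [j == k]eq_sym.
have [/andP[/eqP-> /eqP->]|_] := boolP (_ && _); last by rewrite scale0r.
by rewrite scale1r -[X in (X - _)%MM]add0m addmK mpolyX0.
Qed.

Lemma X_is_linear s t : linear (X s t).
Proof.
move=> c f g; rewrite !dotvdE scaler_sumr -big_split; apply: eq_bigr => j _ /=.
by rewrite linearP mulrDr scalerAr.
Qed.

HB.instance Definition _ s t :=
  GRing.isLinear.Build CC P P *:%R (X s t) (X_is_linear s t).

Lemma D_is_linear s t : linear (D s t).
Proof.
move=> c f g; rewrite !dotddE scaler_sumr -big_split; apply: eq_bigr => j _ /=.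
by rewrite !linearP.
Qed.

HB.instance Definition _ s t :=
  GRing.isLinear.Build CC P P *:%R (D s t) (D_is_linear s t).

Lemma sum_delta (F : 'I_m -> P) (e : bool) k :
  \sum_(j < m) (e && (j == k))%:R * F j = F k *+ e.
Proof.
rewrite (bigD1 k) //= eqxx andbT big1 => [|j /negPf->]; last by rewrite andbF mul0r.
by rewrite addr0 mulr_natl.
Qed.

Lemma pd_M t j a b : pd t j (M a b) = var b j *+ (t == a) + var a j *+ (t == b).
Proof.
rewrite !dotvvE raddf_sum -[var b j *+ _]sum_delta -[var a j *+ _]sum_delta -big_split.
apply: eq_bigr => k _ /=.
by rewrite pdM !pd_var [j == k]eq_sym [var a k * _]mulrC.
Qed.

Lemma pd_X t j a b f : pd t j (X a b f) = X a b (pd t j f) + pd b j f *+ (t == a).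
Proof.
rewrite !dotvdE raddf_sum -[pd b j f *+ _](sum_delta (pd b ^~ f)) -big_split.
apply: eq_bigr => k _ /=.
by rewrite pdM pd_var [j == k]eq_sym addrC pdC.
Qed.

Lemma D_X s t a b f :
  D s t (X a b f) = X a b (D s t f) + D s b f *+ (t == a) + D t b f *+ (s == a).
Proof.
rewrite !dotddE raddf_sum -!sumrMnl -!big_split; apply: eq_bigr => j _ /=.
rewrite pd_X pdD pdMn pd_X [pd b j (pd t j f)]pdC; ring.
Qed.

(** Leibniz twice in a single coordinate j. Summing over j turns the last bracket into the multiples
    of m in [D_M]. *)
Lemma pd_pd_M s t j a b f :
  pd s j (pd t j (M a b * f)) = M a b * pd s j (pd t j f)
    + (var b j * pd s j f) *+ (t == a) + (var a j * pd s j f) *+ (t == b)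
    + (var b j * pd t j f) *+ (s == a) + (var a j * pd t j f) *+ (s == b)
    + (f *+ ((t == a) && (s == b)) + f *+ ((t == b) && (s == a))).
Proof.
have pd_varn a' e : pd s j (var a' j *+ nat_of_bool e) = (e && (s == a'))%:R.
  by rewrite pdMn pd_var eqxx andbT; case: e.
rewrite [pd t j _]pdM pdD [pd s j (pd t j _ * _)]pdM [pd s j (M a b * _)]pdM.
rewrite !pd_M [pd s j (_ + _)]pdD !pd_varn.
move: (pd s j (pd t j f)) (pd s j f) (pd t j f) (var a j) (var b j) (M a b).
move=> f1 f2 f3 va vb mab.
by case: (s == a) (s == b) (t == a) (t == b) => [] [] [] []; rewrite /= ?mulr1n ?mulr0n; ring.
Qed.

Lemma D_M s t a b f :
  D s t (M a b * f) = M a b * D s t f + X b s f *+ (t == a) + X a s f *+ (t == b)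
    + X b t f *+ (s == a) + X a t f *+ (s == b)
    + f *+ (((t == a) && (s == b)) * m + ((t == b) && (s == a)) * m).
Proof.
have -> : f *+ (((t == a) && (s == b)) * m + ((t == b) && (s == a)) * m) =
    \sum_(j < m) (f *+ ((t == a) && (s == b)) + f *+ ((t == b) && (s == a))).
  by rewrite sumr_const card_ord -mulrnDr -mulrnA mulnDl.
rewrite !dotvdE -!sumrMnl !dotddE mulr_sumr -!big_split.
by apply: eq_bigr => j _ /=; exact: pd_pd_M.
Qed.

Lemma X_mul a b f g : X a b (f * g) = X a b f * g + f * X a b g.
Proof.
rewrite !dotvdE mulr_suml mulr_sumr -big_split; apply: eq_bigr => j _ /=.
by rewrite pdM mulrDr mulrA mulrCA.
Qed.

Lemma X_M a b c d : X a b (M c d) = M a d *+ (b == c) + M a c *+ (b == d).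
Proof.
rewrite !dotvdE [M a d]dotvvE [M a c]dotvvE -!sumrMnl -big_split; apply: eq_bigr => j _ /=.
by rewrite pd_M mulrDr !mulrnAr.
Qed.

Lemma X_X a b c d f :
  X a b (X c d f) = X c d (X a b f) + X a d f *+ (b == c) - X c b f *+ (d == a).
Proof.
(* The second-order part of the composite. It is unchanged when the two factors are exchanged, since
   derivatives commute, so it cancels in the commutator. *)
pose T a' b' c' d' :=
  \sum_(j < m) \sum_(k < m) var a' j * var c' k * pd b' j (pd d' k f).
have XX a' b' c' d' : X a' b' (X c' d' f) = X a' d' f *+ (b' == c') + T a' b' c' d'.
  rewrite [LHS]dotvdE [X a' d' f]dotvdE -sumrMnl -big_split; apply: eq_bigr => j _ /=.
  rewrite pd_X mulrDr mulrnAr addrC !dotvdE mulr_sumr; congr (_ + _).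
  by apply: eq_bigr => k _; rewrite mulrA pdC.
have T_sym : T a b c d = T c d a b.
  rewrite [LHS]exchange_big; apply: eq_bigr => j _; apply: eq_bigr => k _ /=.
  by rewrite pdC [var a k * _]mulrC.
apply: (canRL (addrK _)).
by rewrite !XX T_sym [LHS]addrC [LHS]addrA [LHS]addrAC.
Qed.

Lemma D_pd s t a j f : D s t (pd a j f) = pd a j (D s t f).
Proof.
rewrite !dotddE raddf_sum; apply: eq_bigr => k _ /=.
by rewrite [pd t k _]pdC pdC.
Qed.

Lemma D_D s t a b f : D s t (D a b f) = D a b (D s t f).
Proof.
by rewrite [D a b f]dotddE raddf_sum [RHS]dotddE; apply: eq_bigr => k _ /=; rewrite !D_pd.
Qed.

Lemma D_sym s t f : D s t f = D t s f.
Proof. by rewrite !dotddE; apply: eq_bigr => j _; rewrite pdC. Qed.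

Lemma M_sym s t : M s t = M t s.
Proof. by rewrite !dotvvE; apply: eq_bigr => j _; rewrite mulrC. Qed.

Lemma fischer_M s t f g : fischer (M s t * f) g = fischer f (D s t g).
Proof.
rewrite D_sym dotvvE dotddE mulr_suml fischer_suml fischer_sumr; apply: eq_bigr => j _.
by rewrite -mulrA !fischer_mulX.
Qed.

Lemma fischer_X s t f g : fischer (X s t f) g = fischer f (X t s g).
Proof.
rewrite !dotvdE fischer_suml fischer_sumr; apply: eq_bigr => j _.
by rewrite fischer_mulX fischer_deriv.
Qed.

Lemma normx2E : normx2 m = M true true. Proof. by rewrite dotvvE. Qed.
Lemma normu2E : normu2 m = M false false. Proof. by rewrite dotvvE. Qed.
Lemma uxE : ux m = M false true. Proof. by rewrite dotvvE. Qed.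
Lemma XduE f : Xdu f = X true false f. Proof. by rewrite dotvdE. Qed.
Lemma UdxE f : Udx f = X false true f. Proof. by rewrite dotvdE. Qed.
Lemma DuxE f : Dux f = D false true f. Proof. by rewrite dotddE. Qed.
Lemma EulxE f : Eulx f = X true true f. Proof. by rewrite dotvdE. Qed.
Lemma EuluE f : Eulu f = X false false f. Proof. by rewrite dotvdE. Qed.

Lemma dharmE f : dharm f <-> D true true f = 0 /\ D false false f = 0.
Proof. by rewrite !dotddE. Qed.

End Operators.

(* Locked for the same reason as the scalar products above. *)
HB.lock Definition rot m (g : 'M[RR]_m) (f : Pol m) : Pol m := SOact g f.

(** * The projection and the transvector relations *)

Section Transvector.
Variable m : nat.
Local Notation P := (Pol m).
Local Notation X := (@dotvd m).
Local Notation D := (@dotdd m).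
Local Notation L s := (@dotdd m s s).
Local Notation A := (@dotdd m false true).
Local Notation E s := (@dotvd m s s).
Local Notation S s := (@dotvd m s (~~ s)).
Local Notation R s := (@dotvv m s s).
Local Notation U := (@dotvv m false true).
Implicit Types (s : bool) (f g h : P) (a b : CC).

Definition inI f := exists g h, f = R true * g + R false * h.

Lemma inI0 : inI 0.
Proof. by exists 0, 0; rewrite !mulr0 addr0. Qed.

Lemma inID f g : inI f -> inI g -> inI (f + g).
Proof.
move=> [f1 [f2 ->]] [g1 [g2 ->]]; exists (f1 + g1), (f2 + g2).
by rewrite !mulrDr addrACA.
Qed.

Lemma inIM f g : inI f -> inI (g * f).
Proof. by move=> [f1 [f2 ->]]; exists (g * f1), (g * f2); ring. Qed.

Lemma inI_R s f : inI (R s * f).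
Proof.
by case: s; [exists f, 0; rewrite mulr0 addr0 | exists 0, f; rewrite mulr0 add0r].
Qed.

(** Multiplication by [R s] is adjoint to the Laplacian [L s], so such an f is orthogonal to
    itself. *)
Lemma dharm_inI f : dharm f -> inI f -> f = 0.
Proof.
move=> /dharmE[Lx Lu] [g [h Ef]]; apply: fischer_eq0.
by rewrite {1}Ef fischerDl !fischer_M Lx Lu !fischer0r addr0.
Qed.

Lemma dharmB f g : dharm f -> dharm g -> dharm (f - g).
Proof.
move=> /dharmE[fx fu] /dharmE[gx gu]; apply/dharmE.
by rewrite !raddfB /= fx fu gx gu subr0.
Qed.

Lemma dharm_mod f g : dharm f -> dharm g -> inI (f - g) -> f = g.
Proof.
move=> hf hg I_fg; apply/eqP; rewrite -subr_eq0; apply/eqP.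
by apply: dharm_inI I_fg; apply: dharmB.
Qed.

Lemma sdecomp_mod f h : sdecomp f h -> dharm h /\ inI (f - h).
Proof.
case=> -[[? []] //|N] [G [_ [hG [<- ->]]]]; split=> //.
rewrite big_ord_recl /= big_ord_recl /= !expr0 !mul1r addrAC [_ + _ - _]addrAC subrr add0r.
apply: inID; apply: (big_ind _ inI0 inID) => i _.
  by rewrite mul1r exprS -mulrA; rewrite normu2E; exact: (inI_R false).
by apply: (big_ind _ inI0 inID) => j _; rewrite exprS -!mulrA normx2E; exact: (inI_R true).
Qed.

(** The chosen component and h both agree with f modulo the ideal and are both harmonic, hence
    equal: the choice in [pis] is harmless. *)
Lemma pis_sdecomp f h : sdecomp f h -> pis f = h.
Proof.
move=> fh; have /sdecomp_mod[hp Ip] : sdecomp f (pis f).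
  by apply: epsilon_spec; exists h.
have [hh Ih] := sdecomp_mod fh.
apply: dharm_mod => //.
have -> : pis f - h = (f - h) + (-1) * (f - pis f) by ring.
by apply: inID => //; apply: inIM.
Qed.

(** The operators projected below produce at most one factor |x|^2 and one factor |u|^2, so four
    harmonic components are enough. *)
Lemma pis_quad f g00 g10 g01 g11 :
  dharm g00 -> dharm g10 -> dharm g01 -> dharm g11 ->
  f = g00 + R true * g10 + R false * g01 + R true * R false * g11 -> pis f = g00.
Proof.
move=> h00 h10 h01 h11 ->; apply: pis_sdecomp.
exists 2%N, (fun i j => if i == 0%N then if j == 0%N then g00 else g01
                   else if j == 0%N then g10 else g11).
split; first by []. split; first by do 2![case=> [|?] /=].
split; first by [].
rewrite !big_ord_recl !big_ord0 /= /bump /= !expr0 !expr1 normx2E normu2E.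
ring.
Qed.

Lemma dharm0 : dharm (0 : P).
Proof. by apply/dharmE; rewrite !raddf0. Qed.

Lemma pis0 : pis (0 : P) = 0.
Proof. by apply: (@pis_quad 0 0 0 0 0 dharm0 dharm0 dharm0 dharm0); ring. Qed.

(** From here to [S_U]: the brackets of sp(4), read off from the general relations above. An [N]
    after an operator letter in a name means that this operator is taken at [~~ s]. *)
Lemma L_S s f : L s (S s f) = S s (L s f) + A f *+ 2.
Proof. by rewrite D_X; case: s; rewrite /= ?(D_sym true false); ring. Qed.

Lemma LN_S s f : L (~~ s) (S s f) = S s (L (~~ s) f).
Proof. by rewrite D_X; case: s; rewrite /=; ring. Qed.

Lemma A_S s f : A (S s f) = S s (A f) + L (~~ s) f.
Proof. by rewrite D_X; case: s; rewrite /=; ring. Qed.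

Lemma E_S s f : E s (S s f) = S s (E s f) + S s f.
Proof. by rewrite [LHS]X_X; case: s; rewrite /=; ring. Qed.

Lemma EN_S s f : E (~~ s) (S s f) = S s (E (~~ s) f) - S s f.
Proof. by rewrite [LHS]X_X; case: s; rewrite /=; ring. Qed.

Lemma S_S s f : S s (S (~~ s) f) = S (~~ s) (S s f) + E s f - E (~~ s) f.
Proof. by rewrite [LHS]X_X; case: s; rewrite /=; ring. Qed.

Lemma L_A s f : L s (A f) = A (L s f).
Proof. exact: D_D. Qed.

Lemma E_A s f : E s (A f) = A (E s f) - A f.
Proof. by rewrite D_X; case: s; rewrite /= ?(D_sym true false); ring. Qed.

Lemma L_R s f : L s (R s * f) = R s * L s f + E s f *+ 4 + (m%:R)%:MP * f *+ 2.
Proof. by rewrite D_M eqxx /= !mul1n mulrnDr mpolyC_nat mulr_natl; move: (f *+ m) => fm; ring. Qed.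

Lemma LN_R s f : L (~~ s) (R s * f) = R s * L (~~ s) f.
Proof. by rewrite D_M; case: s; rewrite /= ?mul0n; ring. Qed.

Lemma A_R s f : A (R s * f) = R s * A f + S s f *+ 2.
Proof. by rewrite D_M; case: s; rewrite /= ?mul0n; ring. Qed.

Lemma E_R s f : E s (R s * f) = R s * E s f + R s * f *+ 2.
Proof. by rewrite X_mul X_M eqxx /=; ring. Qed.

Lemma EN_R s f : E (~~ s) (R s * f) = R s * E (~~ s) f.
Proof. by rewrite X_mul X_M; case: s; rewrite /=; ring. Qed.

Lemma S_R s f : S s (R s * f) = R s * S s f.
Proof. by rewrite X_mul X_M; case: s; rewrite /=; ring. Qed.

Lemma SN_R s f : S (~~ s) (R s * f) = R s * S (~~ s) f + U * f *+ 2.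
Proof. by rewrite X_mul X_M; case: s; rewrite /= ?(M_sym _ true false); ring. Qed.

Lemma L_U s f : L s (U * f) = U * L s f + S (~~ s) f *+ 2.
Proof. by rewrite D_M; case: s; rewrite /= ?mul0n; ring. Qed.

Lemma A_U f : A (U * f) = U * A f + E true f + E false f + (m%:R)%:MP * f.
Proof. by rewrite D_M /= mul0n mul1n add0n mpolyC_nat mulr_natl; move: (f *+ m) => fm; ring. Qed.

Lemma E_U s f : E s (U * f) = U * E s f + U * f.
Proof. by rewrite X_mul X_M; case: s; rewrite /= ?(M_sym _ true false); ring. Qed.

Lemma S_U s f : S s (U * f) = U * S s f + R s * f.
Proof. by rewrite X_mul X_M; case: s; rewrite /= ?(M_sym _ true false); ring. Qed.

Lemma X_C s t c f : X s t (c%:MP * f) = c%:MP * X s t f.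
Proof. by rewrite !mul_mpolyC linearZ. Qed.

Lemma D_C s t c f : D s t (c%:MP * f) = c%:MP * D s t f.
Proof. by rewrite !mul_mpolyC linearZ. Qed.

(** Half the scalar by which [L s] composed with multiplication by [R s] acts on harmonics of degree
    a - 1 in s. *)
Definition den a : CC := m%:R + 2 * a - 2.
Local Notation K a := (den a)^-1.

(* [wt s a b f]: [f] is double harmonic of degree [a] in the vector [s] and [b]
   in the other one, the degrees being eigenvalues of the Euler operators, so
   that [a - 1] is never truncated. *)
Definition wt s a b f :=
  [/\ L s f = 0, L (~~ s) f = 0, E s f = a%:MP * f & E (~~ s) f = b%:MP * f].

Lemma wt_sym s a b f : wt s a b f -> wt (~~ s) b a f.
Proof. by move=> [? ? ? ?]; split; rewrite ?negbK. Qed.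

Lemma wt_dharm s a b f : wt s a b f -> dharm f.
Proof. by case: s => -[? ? _ _]; apply/dharmE. Qed.

Lemma wtD s a b f g : wt s a b f -> wt s a b g -> wt s a b (f + g).
Proof.
move=> [f1 f2 f3 f4] [g1 g2 g3 g4].
by split; rewrite linearD /= ?f1 ?f2 ?f3 ?f4 ?g1 ?g2 ?g3 ?g4 ?addr0 ?mulrDr.
Qed.

Lemma wtC s a b c f : wt s a b f -> wt s a b (c%:MP * f).
Proof.
move=> [f1 f2 f3 f4].
by split; rewrite ?X_C ?D_C ?f1 ?f2 ?f3 ?f4 ?mulr0 // mulrCA.
Qed.

Lemma wt_A s a b f : wt s a b f -> wt s (a - 1) (b - 1) (A f).
Proof.
move=> [f1 f2 f3 f4]; split.
- by rewrite L_A f1 raddf0.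
- by rewrite L_A f2 raddf0.
- by rewrite E_A f3 D_C; ring.
- by rewrite E_A f4 D_C; ring.
Qed.

(* On degrees [(a, b)], [Sop] and [Cdef] are [pi_s S_s] and [pi_s <u,x>]: the
   coefficients of [R s] and [R (~~ s)] are forced by the two Laplacians. *)
Definition Sop s a f := S s f - (K a)%:MP * (R s * A f).

Definition Cdef s a b f := U * f - (K a)%:MP * (R s * S (~~ s) f)
  - (K b)%:MP * (R (~~ s) * S s f) + (K a * K b)%:MP * (R s * (R (~~ s) * A f)).

Lemma Cdef_sym s a b f : Cdef (~~ s) b a f = Cdef s a b f.
Proof. by rewrite /Cdef negbK; ring. Qed.

Lemma denVK a : den a != 0 -> (K a)%:MP * (den a)%:MP = 1 :> P.
Proof. by move=> da; rewrite -mpolyCM mulVf // mpolyC1. Qed.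

Lemma wt_Sop s a b f : wt s a b f -> den a != 0 -> wt s (a + 1) (b - 1) (Sop s a f).
Proof.
move=> wf da; have [g1 g2 g3 g4] := wt_A wf; case: wf => f1 f2 f3 f4; split.
- rewrite raddfB /= D_C L_S L_R f1 g1 g3 raddf0.
  transitivity ((1 - (K a)%:MP * (den a)%:MP) * A f *+ 2); first by rewrite /den; ring.
  by rewrite denVK // subrr mul0r mul0rn.
- by rewrite raddfB /= D_C LN_S LN_R f2 g2 raddf0; ring.
- by rewrite raddfB /= X_C E_S E_R f3 g3 X_C /Sop; ring.
- by rewrite raddfB /= X_C EN_S EN_R f4 g4 X_C /Sop; ring.
Qed.

Lemma Cdef_inI s a b f : inI (Cdef s a b f - U * f).
Proof.
have -> : Cdef s a b f - U * f = (- K a)%:MP * (R s * S (~~ s) f)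
  + ((- K b)%:MP * (R (~~ s) * S s f) + (K a * K b)%:MP * (R s * (R (~~ s) * A f))).
  by rewrite /Cdef; ring.
by do 2?apply: inID; apply/inIM/inI_R.
Qed.

Lemma pis_S s a b f : wt s a b f -> den a != 0 -> pis (S s f) = Sop s a f.
Proof.
move=> wf da; have hA := wt_dharm (wtC (K a) (wt_A wf)).
have hS := wt_dharm (wt_Sop wf da); have h0 := dharm0.
case: s wf hS hA => wf hS hA.
- by apply: (pis_quad hS hA h0 h0); rewrite /Sop; ring.
- by apply: (pis_quad hS h0 hA h0); rewrite /Sop; ring.
Qed.

Lemma wt_Cdef s a b f : wt s a b f -> den a != 0 -> den b != 0 ->
  wt s (a + 1) (b + 1) (Cdef s a b f).
Proof.
(* By [Cdef_sym], the conditions for the other vector are those for s with the two degrees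
   exchanged. *)
suff half s' a' b' : wt s' a' b' f -> den a' != 0 -> den b' != 0 ->
    L s' (Cdef s' a' b' f) = 0 /\ E s' (Cdef s' a' b' f) = (a' + 1)%:MP * Cdef s' a' b' f.
  move=> wf da db; have [? ?] := half _ _ _ wf da db.
  have [] := half _ _ _ (wt_sym wf) db da; rewrite Cdef_sym => ? ?.
  by split.
move=> wf da db.
have [g1 g2 g3 g4] := wt_A wf; case: wf => f1 f2 f3 f4.
have LSN : L s' (S (~~ s') f) = 0 by have := LN_S (~~ s') f; rewrite negbK f1 raddf0.
have ESN : E s' (S (~~ s') f) = (a' - 1)%:MP * S (~~ s') f.
  by have := EN_S (~~ s') f; rewrite negbK f3 X_C => ->; ring.
have LRN h : L s' (R (~~ s') * h) = R (~~ s') * L s' h.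
  by have := LN_R (~~ s') h; rewrite negbK.
have ERN h : E s' (R (~~ s') * h) = R (~~ s') * E s' h.
  by have := EN_R (~~ s') h; rewrite negbK.
rewrite /Cdef !raddfD !raddfN /= !X_C !D_C; split.
- rewrite L_U f1 !L_R !LRN LSN L_S f1 g1 ESN raddf0 ERN g3.
  transitivity ((1 - (K a')%:MP * (den a')%:MP)
    * (S (~~ s') f - (K b')%:MP * (R (~~ s') * A f)) *+ 2); first by rewrite /den; ring.
  by rewrite denVK // subrr mul0r mul0rn.
- by rewrite E_U f3 !E_R !ERN ESN E_S f3 g3 X_C; ring.
Qed.

Lemma pis_U s a b f : wt s a b f -> den a != 0 -> den b != 0 ->
  pis (U * f) = Cdef s a b f.
Proof.
move=> wf da db; have hC := wt_dharm (wt_Cdef wf da db).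
have hA := wt_dharm (wtC (K a * K b) (wt_A wf)).
have hS := wt_dharm (wtC (K b) (wt_Sop wf da)).
have hSN := wt_dharm (wtC (K a) (wt_Sop (wt_sym wf) db)).
case: s wf hC hS hSN => wf hC hS hSN.
- by apply: (pis_quad hC hSN hS hA); rewrite /Cdef /Sop /=; ring.
- by apply: (pis_quad hC hS hSN hA); rewrite /Cdef /Sop /=; ring.
Qed.

Lemma pis_A s a b f : wt s a b f -> pis (A f) = A f.
Proof.
move=> wf; have h0 := dharm0.
by apply: (pis_quad (wt_dharm (wt_A wf)) h0 h0 h0); ring.
Qed.

Lemma inI_R2 s g h : inI (R s * g + R (~~ s) * h).
Proof. by apply: inID; apply: inI_R. Qed.

(** Both sides are double harmonic, so it suffices to compare them modulo the ideal. The factor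
    [1 - 2 * K b] arises because moving [S s] past [R (~~ s)] releases [U * S s g] twice. *)
Lemma Sop_Cdef s a b g : wt s a b g ->
  den a != 0 -> den b != 0 -> den (a + 1) != 0 -> den (b - 1) != 0 ->
  Sop s (a + 1) (Cdef s a b g) =
  (1 - 2 * K b)%:MP * Cdef s (a + 1) (b - 1) (Sop s a g).
Proof.
move=> wg da db da1 db1; have wC := wt_Cdef wg da db; have wS := wt_Sop wg da.
apply: dharm_mod.
- exact: wt_dharm (wt_Sop wC da1).
- exact: wt_dharm (wtC _ (wt_Cdef wS da1 db1)).
set Cg := Cdef s a b g; set Sg := Sop s a g.
have SRN h : S s (R (~~ s) * h) = R (~~ s) * S s h + U * h *+ 2.
  by have := SN_R (~~ s) h; rewrite negbK.
have SCg : S s Cg = U * S s g + R s * g - (K a)%:MP * (R s * S s (S (~~ s) g))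
   - (K b)%:MP * (R (~~ s) * S s (S s g) + U * S s g *+ 2)
   + (K a * K b)%:MP * (R s * S s (R (~~ s) * A g)).
  by rewrite /Cg /Cdef raddfD raddfB raddfB /= !X_C S_U !S_R SRN.
rewrite {1}/Sop SCg {1}/Cdef.
have ESg : Sg = S s g - (K a)%:MP * (R s * A g) by [].
rewrite {1}ESg.
(* [w1] and [w2] collect the cofactors of [R s] and [R (~~ s)] in the difference of the two
   sides. *)
set w1 := g - (K a)%:MP * S s (S (~~ s) g) + (K a * K b)%:MP * S s (R (~~ s) * A g)
  - (K (a + 1))%:MP * A Cg + (1 - 2 * K b)%:MP * ((K a)%:MP * (U * A g)
  + (K (a + 1))%:MP * S (~~ s) Sg - (K (a + 1) * K (b - 1))%:MP * (R (~~ s) * A Sg)).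
set w2 := (1 - 2 * K b)%:MP * (K (b - 1))%:MP * S s Sg - (K b)%:MP * S s (S s g).
have := inI_R2 s w1 w2; congr inI; rewrite /w1 /w2.
ring.
Qed.

(** Again a comparison modulo the ideal. On the left [U * A f] gets the coefficient 1 + 4 K a K b.
    On the right each of the two products of [Sop] contributes 4 K a K b to it, which leaves 1 - 4 K
    a K b for the [Cdef] term. *)
Lemma A_Cdef a b f : wt true a b f -> den a != 0 -> den b != 0 ->
  den (a - 1) != 0 -> den (b - 1) != 0 ->
  A (Cdef true a b f) = (m%:R + a + b)%:MP * f
    + (1 - 4 * K a * K b)%:MP * Cdef true (a - 1) (b - 1) (A f)
    - (2 * K a)%:MP * Sop true (a - 1) (Sop false b f)
    - (2 * K b)%:MP * Sop false (b - 1) (Sop true a f).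
Proof.
move=> wf da db da1 db1.
have wA := wt_A wf; have wC := wt_Cdef wf da db.
have wxu : wt true (a - 1 + 1) (b + 1 - 1) (Sop true (a - 1) (Sop false b f)).
  apply: wt_Sop da1; exact: wt_sym (wt_Sop (wt_sym wf) db).
have wux : wt true (a + 1 - 1) (b - 1 + 1) (Sop false (b - 1) (Sop true a f)).
  apply: (wt_sym (s := false)); apply: wt_Sop db1; exact: wt_sym (wt_Sop wf da).
rewrite !addrK !subrK in wxu wux.
apply: dharm_mod.
- by apply: wt_dharm (wt_A wC).
- have wCA := wt_Cdef wA da1 db1; rewrite !subrK in wCA.
  apply: (wt_dharm (s := true) (a := a) (b := b)); apply: wtD; last first.
    by rewrite -mulNr -mpolyCN; exact: wtC.
  apply: wtD; last by rewrite -mulNr -mpolyCN; exact: wtC.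
  by apply: wtD; exact: wtC.
have AC : A (Cdef true a b f) = U * A f + (m%:R + a + b)%:MP * f
   - (K a)%:MP * (R true * A (X false true f) + X true false (X false true f) *+ 2)
   - (K b)%:MP * (R false * A (X true false f) + X false true (X true false f) *+ 2)
   + (K a * K b)%:MP * (R true * A (R false * A f)
       + (R false * X true false (A f) + U * A f *+ 2) *+ 2).
  case: wf => _ _ f3 f4.
  rewrite /Cdef raddfD raddfB raddfB /= !D_C A_U !A_R (SN_R false) /= f3 f4.
  by ring.
have Sxu : X true false (Sop false b f) = X true false (X false true f)
    - (K b)%:MP * (R false * X true false (A f) + U * A f *+ 2).
  by rewrite /Sop raddfB /= X_C (SN_R false).
have Sux : X false true (Sop true a f) = X false true (X true false f)
    - (K a)%:MP * (R true * X false true (A f) + U * A f *+ 2).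
  by rewrite /Sop raddfB /= X_C (SN_R true).
rewrite AC /Cdef [Sop true (a - 1) _]/Sop Sxu [Sop false (b - 1) _]/Sop Sux /=.
set Sf := Sop false b f; set Sf' := Sop true a f.
set w1 := (K a * K b)%:MP * A (R false * A f) - (K a)%:MP * A (X false true f)
  + (1 - 4 * K a * K b)%:MP * ((K (a - 1))%:MP * X false true (A f)
      - (K (a - 1) * K (b - 1))%:MP * (R false * A (A f)))
  - (2 * K a * K (a - 1))%:MP * A Sf - (2 * K a * K b)%:MP * X false true (A f).
set w2 := - (K b)%:MP * A (X true false f)
  + (1 - 4 * K a * K b)%:MP * ((K (b - 1))%:MP * X true false (A f))
  - (2 * K b * K (b - 1))%:MP * A Sf'.
have := inI_R2 true w1 w2; congr inI; rewrite /w1 /w2 /=.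
ring.
Qed.

(* The arguments of [den] that occur; [a = -1], where [den a = m - 4], is the
   reason for assuming [4 < m]. *)
Definition deg1 a := exists n : nat, a = n%:R - 1.

Lemma deg1_nat (n : nat) : deg1 n%:R.
Proof. by exists n.+1; rewrite -natr1 addrK. Qed.

Lemma deg1_predn (n : nat) : deg1 (n%:R - 1).
Proof. by exists n. Qed.

Lemma deg1D a (n : nat) : deg1 a -> deg1 (a + n%:R).
Proof. by move=> [q ->]; exists (q + n)%N; rewrite natrD addrAC. Qed.

Lemma deg1_add1 a : deg1 a -> deg1 (a + 1).
Proof. exact: (@deg1D a 1). Qed.

Lemma den_neq0 a : (4 < m)%N -> deg1 a -> den a != 0.
Proof.
move=> hm [n ->].
have -> : den (n%:R - 1) = (m - 4 + 2 * n)%:R by rewrite /den natrD natrM natrB 1?ltnW //; ring.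
by rewrite pnatr_eq0 addn_eq0 subn_eq0 leqNgt hm.
Qed.

(** * Action of the generators on powers of C *)

Hypothesis hm : (4 < m)%N.
Let denN a : deg1 a -> den a != 0 := @den_neq0 a hm.
Local Notation T s f := (pis (S s f)).

Lemma wt0 s a b : wt s a b (0 : P).
Proof. by split; rewrite raddf0 ?mulr0. Qed.

Lemma SuE f : Su f = T false f.
Proof. by rewrite /Su UdxE. Qed.

Lemma SxE f : Sx f = T true f.
Proof. by rewrite /Sx XduE. Qed.

Lemma CopE s a b f : wt s a b f -> deg1 a -> deg1 b -> Cop f = Cdef s a b f.
Proof. by move=> wf da db; rewrite /Cop uxE (pis_U wf) ?denN. Qed.

Lemma TE s a b f : wt s a b f -> deg1 a -> T s f = Sop s a f.
Proof. by move=> wf da; rewrite (pis_S wf) ?denN. Qed.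

Lemma AopE s a b f : wt s a b f -> Aop f = A f.
Proof. by move=> wf; rewrite /Aop DuxE (pis_A wf). Qed.

Lemma wt_T s a b f : wt s a b f -> deg1 a -> wt s (a + 1) (b - 1) (T s f).
Proof. by move=> wf da; rewrite (TE wf) //; apply: wt_Sop; rewrite ?denN. Qed.

Lemma wt_Cop s a b f : wt s a b f -> deg1 a -> deg1 b -> wt s (a + 1) (b + 1) (Cop f).
Proof. by move=> wf da db; rewrite (CopE wf) //; apply: wt_Cdef; rewrite ?denN. Qed.

Lemma Cop_C s a b c f : wt s a b f -> deg1 a -> deg1 b ->
  Cop (c%:MP * f) = c%:MP * Cop f.
Proof.
move=> wf da db; rewrite (CopE wf) // (CopE (wtC c wf)) //.
by rewrite /Cdef !X_C !D_C; ring.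
Qed.

Lemma T_C s a b c f : wt s a b f -> deg1 a -> T s (c%:MP * f) = c%:MP * T s f.
Proof.
move=> wf da; rewrite (TE wf) // (TE (wtC c wf)) //.
by rewrite /Sop !X_C !D_C; ring.
Qed.

Lemma Cop0 : Cop (0 : P) = 0.
Proof. by rewrite /Cop mulr0 pis0. Qed.

Lemma Su0 : Su (0 : P) = 0.
Proof. by rewrite SuE raddf0 pis0. Qed.

Lemma wt_iterC s a b f (i : nat) : wt s a b f -> deg1 a -> deg1 b ->
  wt s (a + i%:R) (b + i%:R) (iter i (@Cop m) f).
Proof.
move=> wf da db; elim: i => [|i IHi]; first by rewrite !addr0.
by rewrite -!natr1 !addrA; apply: wt_Cop IHi _ _; apply: deg1D.
Qed.

Lemma iterC_C s a b c f (i : nat) : wt s a b f -> deg1 a -> deg1 b ->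
  iter i (@Cop m) (c%:MP * f) = c%:MP * iter i (@Cop m) f.
Proof.
move=> wf da db; elim: i => [//|i IHi]; rewrite !iterS IHi.
by apply: Cop_C (wt_iterC i wf da db) _ _; apply: deg1D.
Qed.

Lemma iterC0 (i : nat) : iter i (@Cop m) 0 = 0.
Proof. by elim: i => [//|i IHi]; rewrite iterS IHi Cop0. Qed.

(** Each passage through C costs the factor of [Sop_Cdef]. As [den] grows by 2 per degree, this is a
    quotient of consecutive values of [den], and the product telescopes. *)
Lemma T_iterC s a b f (i : nat) : wt s a b f -> deg1 a -> deg1 b -> deg1 (b - 1) ->
  T s (iter i (@Cop m) f) =
  (den (b - 1) / den (b - 1 + i%:R))%:MP * iter i (@Cop m) (T s f).
Proof.
move=> wf da db db1; have wT := wt_T wf da; have da1 := deg1_add1 da.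
elim: i => [|i IHi]; first by rewrite addr0 divff ?denN // mpolyC1 mul1r.
have wi := wt_iterC i wf da db; have wTi := wt_iterC i wT da1 db1.
have dai := deg1D i da; have dbi := deg1D i db.
have db1i := deg1D i db1; have db1i1 := deg1D i.+1 db1.
have dai1 := deg1_add1 dai.
have eb : b + i%:R - 1 = b - 1 + i%:R by ring.
have wTCi : wt s (a + i%:R + 1) (b + i%:R - 1) (T s (iter i (@Cop m) f)).
  exact: wt_T.
rewrite !iterS (CopE wi) // (TE (wt_Cdef wi (denN dai) (denN dbi))) //.
rewrite (Sop_Cdef wi) ?denN // ?eb // -(TE wi) //.
rewrite eb in wTCi; rewrite -(CopE wTCi) // IHi (Cop_C _ wTi) //; last first.
  by rewrite addrAC.
rewrite mulrA -mpolyCM; congr (_%:MP * _).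
have -> : 1 - 2 / den (b + i%:R) = den (b - 1 + i%:R) / den (b + i%:R).
  apply: (canRL (mulfK (denN dbi))).
  by rewrite mulrBl mul1r divfK ?denN // /den; ring.
have -> : b - 1 + i.+1%:R = b + i%:R by rewrite -natr1; ring.
by field; rewrite !denN.
Qed.

Lemma TT_iterC s a b g e (i : nat) : wt s a b g -> deg1 (a - 1) -> deg1 b ->
  T s (T (~~ s) g) = e%:MP * g ->
  T s (T (~~ s) (iter i (@Cop m) g)) =
  (den (a - 1) * den b / (den (a - 1 + i%:R) * den (b + i%:R)) * e)%:MP
    * iter i (@Cop m) g.
Proof.
move=> wg da1 db TTg.
have da : deg1 a by rewrite -[a](subrK 1); apply: deg1_add1.
have wN := wt_sym wg; have wTN := wt_T wN db.
have wT : wt s (a - 1) (b + 1) (T (~~ s) g) by have := wt_sym wTN; rewrite negbK.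
have db1 := deg1_add1 db.
rewrite (T_iterC i wN) // (T_C _ (wt_iterC i wT _ _)) //; last exact: deg1D.
rewrite (T_iterC i wT) ?addrK // TTg (iterC_C _ _ wg) // !mulrA -!mpolyCM.
by congr (_%:MP * _); field; rewrite !denN //; apply: deg1D.
Qed.

(* The solution of the recurrence that [A_Cdef] gives for the scalars in
   [A C^i g = Ccoef i C^(i-1) g]. *)
Definition Ccoef a b k l (i : nat) : CC :=
  i%:R * (m%:R + k + l + i%:R - 3) * den (l + i%:R - 1) * den (k + i%:R)
    / (den (a - 1 + i%:R) * den (b - 1 + i%:R)).

(** This is [A_Cdef] read on C^i g. For g = S_u^j H, the scalars of S_x S_u and S_u S_x on g are
    [(j + 1) * (k - l - j)] and [j * (k - l - j + 1)], and [TT_iterC] carries them to C^i g. With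
    complex parameters it is an identity of rational functions. *)
Lemma Ccoef_rec (k l j : CC) (i : nat) (a := k - j) (b := l + j) :
  deg1 (a - 1) -> deg1 (b - 1) ->
  Ccoef a b k l i.+1 = m%:R + (a + i%:R) + (b + i%:R)
    + (1 - 4 * K (a + i%:R) * K (b + i%:R)) * Ccoef a b k l i
    - 2 * K (a + i%:R) * (den (a - 1) * den b
        / (den (a - 1 + i%:R) * den (b + i%:R)) * ((j + 1) * (k - l - j)))
    - 2 * K (b + i%:R) * (den (b - 1) * den a
        / (den (b - 1 + i%:R) * den (a + i%:R)) * (j * (k - l - j + 1))).
Proof.
move=> da1 db1.
have da : deg1 a by rewrite -[a](subrK 1); apply: deg1_add1.
have db : deg1 b by rewrite -[b](subrK 1); apply: deg1_add1.
move: (denN (deg1D i da)) (denN (deg1D i db)) (denN (deg1D i da1)) (denN (deg1D i db1)).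
rewrite /Ccoef -natr1 /den /a /b; move: (m%:R : CC) (i%:R : CC) => n x na nb na1 nb1.
by field; apply/and4P; split.
Qed.

Lemma A_iterC (k l j : CC) g (i : nat) (a := k - j) (b := l + j) :
  wt true a b g -> A g = 0 ->
  T true (T false g) = ((j + 1) * (k - l - j))%:MP * g ->
  T false (T true g) = (j * (k - l - j + 1))%:MP * g ->
  deg1 (a - 1) -> deg1 (b - 1) ->
  A (iter i.+1 (@Cop m) g) = (Ccoef a b k l i.+1)%:MP * iter i (@Cop m) g.
Proof.
move=> wg Ag TT1 TT2 da1 db1.
have da : deg1 a by rewrite -[a](subrK 1); apply: deg1_add1.
have db : deg1 b by rewrite -[b](subrK 1); apply: deg1_add1.
(* The previous power enters [A_Cdef] only through this premise. For n = 0 both of its sides vanish;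
   for a successor the lowered degrees are those of the previous power, so [Cdef] is [Cop] there. *)
have step n : Cdef true (a + n%:R - 1) (b + n%:R - 1) (A (iter n (@Cop m) g)) =
      (Ccoef a b k l n)%:MP * iter n (@Cop m) g ->
    A (iter n.+1 (@Cop m) g) = (Ccoef a b k l n.+1)%:MP * iter n (@Cop m) g.
  move=> Cn; have wn := wt_iterC n wg da db.
  have dan := deg1D n da; have dbn := deg1D n db.
  have dan1 : deg1 (a + n%:R - 1) by rewrite addrAC; apply: deg1D.
  have dbn1 : deg1 (b + n%:R - 1) by rewrite addrAC; apply: deg1D.
  rewrite iterS (CopE wn) // A_Cdef ?denN // Cn.
  have wnN := wt_sym wn.
  rewrite -(TE wn) // -(TE wnN) //.
  have wT := wt_T wn dan; have wTN := wt_T wnN dbn.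
  have e1 : Sop true (a + n%:R - 1) (T false (iter n (@Cop m) g))
      = T true (T false (iter n (@Cop m) g)).
    by rewrite (TE (wt_sym wTN)).
  have e2 : Sop false (b + n%:R - 1) (T true (iter n (@Cop m) g))
      = T false (T true (iter n (@Cop m) g)).
    by rewrite (TE (wt_sym wT)).
  rewrite e1 e2 (TT_iterC n wg da1 db TT1) (TT_iterC n (wt_sym wg) db1 da TT2).
  by rewrite (Ccoef_rec n da1 db1) -/a -/b; ring.
elim: i => [|i IHi]; apply: step.
  rewrite /= Ag /Ccoef mulr0n !mul0r /Cdef !raddf0 !mulr0.
  by rewrite !subr0 addr0.
have wi := wt_iterC i wg da db.
have [dai dbi] := (deg1D i da, deg1D i db).
have e x : x + i.+1%:R - 1 = x + i%:R by rewrite -natr1 addrA addrK.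
by rewrite IHi !e -(CopE (wtC _ wi)) // (Cop_C _ wi).
Qed.

(** * The module generated by a simplicial harmonic *)

Lemma mcoeff_E s f mo : (E s f)@_mo = (\sum_(j < m) mo (idx s j))%:R * f@_mo.
Proof.
rewrite dotvdE raddf_sum natr_sum mulr_suml; apply: eq_bigr => j _ /=.
have EX mo' : var s j * pd s j 'X_[mo'] = (mo' (idx s j))%:R *: 'X_[mo'].
  rewrite /var /pd mderivX -scalerAr -mpolyXD addmC.
  have [->|nz] := eqVneq (mo' (idx s j)) 0%N; first by rewrite !scale0r.
  by rewrite submK // lep1mP.
rewrite {1}[f]mpolyE raddf_sum mulr_sumr raddf_sum /=.
rewrite [in RHS](mpolyE f) raddf_sum mulr_sumr; apply: eq_bigr => mo' _ /=.
rewrite linearZ -scalerAr EX !mcoeffZ mcoeffX.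
by have [->|_] := eqVneq mo' mo; [ring | rewrite !mulr0].
Qed.

Lemma bihomogP p q f : bihomog p q f <->
  E true f = (p%:R)%:MP * f /\ E false f = (q%:R)%:MP * f.
Proof.
split=> [fpq | [Ex Eu] mo mo_f].
  split; apply/mpolyP=> mo; rewrite mcoeff_E mcoeffCM;
    have [/fpq[ep eq]|/memN_msupp_eq0->] := boolP (mo \in msupp f); rewrite ?mulr0 //.
  - by rewrite -ep.
  - by rewrite -eq.
have deg s r : E s f = (r%:R)%:MP * f -> (\sum_(j < m) mo (idx s j))%N = r.
  move/(congr1 (fun g : P => g@_mo)); rewrite mcoeff_E mcoeffCM.
  move/(mulIf _) => /(_ _)/eqP; rewrite eqr_nat => e; apply/eqP/e.
  by rewrite -mcoeff_msupp.
by split; [exact: (deg true) | exact: (deg false)].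
Qed.

Definition hwv (k l : nat) H := [/\ wt true k%:R l%:R H, A H = 0 & X true false H = 0].

Lemma simpharmP (k l : nat) H : simpharm k l H <-> hwv k l H.
Proof.
rewrite /simpharm bihomogP dharmE DuxE XduE.
by split=> [[[? ?] [[? ?] [? ?]]] | [[? ? ? ?] ? ?]]; do ?split.
Qed.

(** On ker A the correction term of [Sop] vanishes, so S_u is plainly <u, d_x>. It preserves double
    harmonics in ker A because its bracket with A is a Laplacian. *)
Lemma kerA_step a b f : wt true a b f -> A f = 0 -> deg1 b ->
  [/\ Su f = X false true f, A (X false true f) = 0 & wt true (a - 1) (b + 1) (X false true f)].
Proof.
move=> wf Af db; have wN := wt_sym wf.
have eS : Su f = X false true f.
  by rewrite SuE (TE wN) // /Sop Af !mulr0 subr0.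
split=> //; last by rewrite -eS SuE; have := wt_sym (wt_T wN db).
by rewrite (A_S false) Af raddf0; case: wf => -> _ _ _; rewrite addr0.
Qed.

Section Module.
Variables (k l : nat) (H : P).
Hypotheses (le_lk : (l <= k)%N) (hH : hwv k l H).
Local Notation w j := (iter j (@Su m) H).

Lemma iterS_kerA (j : nat) : wt true (k%:R - j%:R) (l%:R + j%:R) (w j) /\ A (w j) = 0.
Proof.
case: hH => wH AH _; elim: j => [|j [wj Aj]]; first by rewrite subr0 addr0.
have [eS ASj wSj] := kerA_step wj Aj (deg1D j (deg1_nat l)).
by rewrite iterS eS -natr1 opprD !addrA.
Qed.

Lemma iterSS (j : nat) : w j.+1 = X false true (w j).
Proof.
have [wj Aj] := iterS_kerA j.
by have [] := kerA_step wj Aj (deg1D j (deg1_nat l)).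
Qed.

(** The usual sl(2) string: the scalar is the sum of the weights k - l - 2n for n from 0 to j. *)
Lemma Xdu_iterS (j : nat) :
  X true false (w j.+1) = (j.+1%:R * (k%:R - l%:R - j%:R))%:MP * w j.
Proof.
have step n : X true false (w n.+1) = X false true (X true false (w n))
    + (k%:R - l%:R - n%:R *+ 2)%:MP * w n.
  have [[_ _ e1 e2] _] := iterS_kerA n; rewrite /= in e2.
  by rewrite iterSS (S_S true) /= e1 e2; ring.
elim: j => [|j IHj]; rewrite step.
  by case: hH => _ _ /= ->; rewrite raddf0; ring.
by rewrite IHj X_C -iterSS -!natr1; ring.
Qed.

(** By adjointness the squared norm of the vector at k - l + 1 contains the scalar of [Xdu_iterS] at
    j = k - l, which is 0. *)
Lemma iterS_eq0 (j : nat) : (k - l < j)%N -> w j = 0.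
Proof.
have w0 : w (k - l).+1 = 0.
  apply: fischer_eq0; rewrite {1}iterSS fischer_X Xdu_iterS natrB // subrr mulr0.
  by rewrite mpolyC0 mul0r fischer0r.
elim: j => [//|j IHj]; rewrite ltnS leq_eqVlt => /orP[/eqP<- //|/IHj].
by rewrite iterS => ->; exact: Su0.
Qed.

Let deg1_hw (j : nat) : (j <= k - l)%N -> deg1 (k%:R - j%:R - 1).
Proof.
move=> le_j; rewrite -natrB; first exact: deg1_predn.
exact: leq_trans le_j (leq_subr _ _).
Qed.

Let deg1_hwN (j : nat) : deg1 (l%:R + j%:R - 1).
Proof. by rewrite -natrD; exact: deg1_predn. Qed.

Let deg1_hw0 (j : nat) : (j <= k - l)%N -> deg1 (k%:R - j%:R).
Proof. by move=> /deg1_hw/deg1_add1; rewrite subrK. Qed.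

Let deg1_hwN0 (j : nat) : deg1 (l%:R + j%:R).
Proof. by rewrite -natrD; exact: deg1_nat. Qed.

Lemma wt_CS (i j : nat) : (j <= k - l)%N ->
  wt true (k%:R - j%:R + i%:R) (l%:R + j%:R + i%:R) (CS i j H).
Proof.
by move=> le_j; apply: (wt_iterC i (proj1 (iterS_kerA j)) (deg1_hw0 le_j) (deg1_hwN0 j)).
Qed.

Definition shiftcoef a (i : nat) : CC := den (a - 1) / den (a - 1 + i%:R).

Lemma Su_CS (i j : nat) : (j <= k - l)%N ->
  Su (CS i j H) = (shiftcoef (k%:R - j%:R) i)%:MP * CS i j.+1 H.
Proof.
move=> le_j; have wN := wt_sym (proj1 (iterS_kerA j)).
by rewrite SuE (T_iterC i wN (deg1_hwN0 _) (deg1_hw0 le_j) (deg1_hw le_j)) -SuE.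
Qed.

Lemma Sx_CS (i j : nat) : (j < k - l)%N ->
  Sx (CS i j.+1 H) =
  (shiftcoef (l%:R + j.+1%:R) i * (j.+1%:R * (k%:R - l%:R - j%:R)))%:MP * CS i j H.
Proof.
move=> lt_j; have [wj Aj] := iterS_kerA j.+1.
have [wj0 _] := iterS_kerA j; have le_j := ltnW lt_j.
have da := deg1_hw0 lt_j.
rewrite SxE (T_iterC i wj da (deg1_hwN0 _) (deg1_hwN _)) (TE wj da) /Sop Aj.
rewrite !mulr0 subr0 Xdu_iterS.
by rewrite (iterC_C _ _ wj0 (deg1_hw0 le_j) (deg1_hwN0 _)) mulrA -mpolyCM.
Qed.

Lemma Sx_CS0 (i : nat) : Sx (CS i 0 H) = 0.
Proof.
have [w0 A0] := iterS_kerA 0; have lt0 : (0 <= k - l)%N by [].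
have da := deg1_hw0 lt0.
rewrite SxE (T_iterC i w0 da (deg1_hwN0 _) (deg1_hwN _)) (TE w0 da) /Sop A0.
by rewrite !mulr0 subr0; case: hH => _ _ /= ->; rewrite iterC0 mulr0.
Qed.

Lemma A_CS0 (j : nat) : A (CS 0 j H) = 0.
Proof. by case: (iterS_kerA j). Qed.

Lemma A_CS (i j : nat) : (j <= k - l)%N ->
  A (CS i.+1 j H) = (Ccoef (k%:R - j%:R) (l%:R + j%:R) k%:R l%:R i.+1)%:MP * CS i j H.
Proof.
move=> le_j; have [wj Aj] := iterS_kerA j; have da := deg1_hw0 le_j.
have [wj1 Aj1] := iterS_kerA j.+1.
have TNj : T false (w j) = w j.+1 by rewrite -SuE.
apply: (A_iterC _ wj Aj) => //; last exact: deg1_hw.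
- have := deg1_hw le_j; rewrite -addrA -opprD natr1 => dj1.
  by rewrite TNj (TE wj1) // /Sop Aj1 !mulr0 subr0 Xdu_iterS.
- rewrite (TE wj) // /Sop Aj !mulr0 subr0 /=.
  case: j le_j {da wj1 Aj1 TNj} wj Aj => [|j] le_j wj Aj.
    by case: hH => _ _ /= ->; rewrite raddf0 pis0 !mul0r.
  rewrite Xdu_iterS (T_C _ (wt_sym (proj1 (iterS_kerA j)))) // -SuE.
  by congr (_%:MP * _); rewrite -natr1; ring.
Qed.

(** As m > 4 and j <= k - l, every factor is a positive integer or the inverse of one. *)
Lemma Ccoef_neq0 (i j : nat) : (j <= k - l)%N ->
  Ccoef (k%:R - j%:R) (l%:R + j%:R) k%:R l%:R i.+1 != 0.
Proof.
move=> le_j; rewrite /Ccoef !mulf_neq0 ?invr_neq0 ?mulf_neq0 ?denN ?pnatr_eq0 //.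
- have -> : m%:R + k%:R + l%:R + i.+1%:R - 3 = (m - 2 + k + l + i)%:R :> CC.
    by rewrite !natrD natrB -?natr1; [ring | lia].
  by rewrite pnatr_eq0; lia.
- by rewrite -natrD; exact: deg1_nat.
- by apply: deg1D; exact: deg1_hw.
- by apply: deg1D; exact: deg1_hwN.
Qed.

(** A strips off the factors C, then <x, d_u> the factors S_u, with nonzero scalars as long as j <=
    k - l. *)
Lemma CS_eq0 (i j : nat) : (j <= k - l)%N -> CS i j H = 0 -> H = 0.
Proof.
move=> le_j; have cancel c f : c != 0 -> c%:MP * f = 0 -> f = 0 :> P.
  by move=> /negPf c0 /eqP; rewrite mul_mpolyC scaler_eq0 c0 => /eqP.
elim: i => [|i IHi] CS0; last first.
  apply/IHi/(cancel _ _ (Ccoef_neq0 i le_j)).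
  by rewrite -A_CS // CS0 raddf0.
move: CS0; rewrite /CS /=; elim: j le_j => [//|j IHj] lt_j wj0.
apply: IHj; first exact: ltnW.
apply: (cancel (j.+1%:R * (k%:R - l%:R - j%:R))); last by rewrite -Xdu_iterS wj0 raddf0.
rewrite mulf_neq0 ?pnatr_eq0 // -!natrB ?pnatr_eq0 ?subn_eq0 -?ltnNge //.
exact: ltnW.
Qed.

End Module.

(** * Orthogonality of the vectors C^i S_u^j H *)

Lemma fischer_inI f g : inI f -> dharm g -> fischer f g = 0.
Proof.
move=> [f1 [f2 ->]] /dharmE[gx gu].
by rewrite fischerDl !fischer_M gx gu !fischer0r addr0.
Qed.

(** C f differs from <u, x> f by an element of the ideal, which is orthogonal to the harmonic g. *)
Lemma fischer_Cop a b f g : wt true a b f -> deg1 a -> deg1 b -> dharm g ->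
  fischer (Cop f) g = fischer f (A g).
Proof.
move=> wf da db hg; rewrite (CopE wf) // -[Cdef _ _ _ _](subrK (U * f)) fischerDl fischer_M.
by rewrite (fischer_inI (Cdef_inI _ _ _ _)) // add0r.
Qed.

Section Orthogonality.
Variables (k l k' l' : nat) (H H' : P).
Hypotheses (hH : hwv k l H) (hH' : hwv k' l' H').

(** The Euler operators are self-adjoint, and one of them has different eigenvalues on H and H'. *)
Lemma fischer_hwv : (k, l) != (k', l') -> fischer H H' = 0.
Proof.
have eq_wt s (a b : nat) : E s H = (a%:R)%:MP * H -> E s H' = (b%:R)%:MP * H' ->
    a != b :> nat -> fischer H H' = 0.
  move=> eH eH' ne_ab; have := fischer_X s s H H'.
  rewrite eH eH' fischerCr mul_mpolyC fischerZl conjC_nat => /eqP.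
  by rewrite -subr_eq0 -mulrBl mulf_eq0 subr_eq0 eqr_nat (negPf ne_ab) => /eqP.
case: hH hH' => [[_ _ e1 e2] _ _] [[_ _ e1' e2'] _ _].
by rewrite xpair_eqE negb_and => /orP[]; [exact: (eq_wt true) | exact: (eq_wt false)].
Qed.

(** Moving <u, d_x> across as <x, d_u> lowers both powers by one, until one of them is 0 and <x,
    d_u> kills the simplicial harmonic. *)
Lemma fischer_iterS (j j' : nat) : (k, l, j) != (k', l', j') ->
  fischer (iter j (@Su m) H) (iter j' (@Su m) H') = 0.
Proof.
elim: j j' => [|j IHj] [|j'].
- by rewrite !xpair_eqE andbT -xpair_eqE; exact: fischer_hwv.
- move=> _; rewrite fischer_conj (iterSS hH') fischer_X.
  by case: hH => _ _ ->; rewrite fischer0r rmorph0.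
- move=> _; rewrite (iterSS hH) fischer_X.
  by case: hH' => _ _ ->; rewrite fischer0r.
- rewrite xpair_eqE eqSS -xpair_eqE => ne_j.
  by rewrite (iterSS hH) fischer_X (Xdu_iterS hH') fischerCr IHj // mulr0.
Qed.

(** Moving C across as A lowers both powers of C by one, until A meets a vector without C and kills
    it; with no C on either side, [fischer_iterS] applies. *)
Lemma fischer_CS (i j i' j' : nat) : (j <= k - l)%N -> (j' <= k' - l')%N ->
  (k, l, i, j) != (k', l', i', j') -> fischer (CS i j H) (CS i' j' H') = 0.
Proof.
move=> le_j le_j'.
have deg k1 l1 j1 (i1 : nat) : (j1 <= k1 - l1)%N ->
    deg1 (k1%:R - j1%:R + i1%:R) /\ deg1 (l1%:R + j1%:R + i1%:R).
  move=> le1; rewrite -natrB; last exact: leq_trans le1 (leq_subr _ _).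
  by rewrite -!natrD; split; exact: deg1_nat.
elim: i i' => [|i IHi] [|i'].
- by rewrite !xpair_eqE andbT -!xpair_eqE; exact: fischer_iterS.
- move=> _; rewrite fischer_conj.
  have [da db] := deg _ _ _ i' le_j'.
  rewrite (fischer_Cop (wt_CS hH' i' le_j')) //.
    by rewrite (A_CS0 hH) fischer0r rmorph0.
  exact: wt_dharm (wt_CS hH 0 le_j).
- move=> _; have [da db] := deg _ _ _ i le_j.
  rewrite (fischer_Cop (wt_CS hH i le_j)) //.
    by rewrite (A_CS0 hH') fischer0r.
  exact: wt_dharm (wt_CS hH' 0 le_j').
- rewrite !xpair_eqE eqSS -!xpair_eqE => ne_i; have [da db] := deg _ _ _ i le_j.
  rewrite (fischer_Cop (wt_CS hH i le_j)) //.
    by rewrite (A_CS hH') // fischerCr IHi // mulr0.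
  exact: wt_dharm (wt_CS hH' i'.+1 le_j').
Qed.

End Orthogonality.

Lemma sum_single (k l N i0 j0 : nat) c (G : nat -> nat -> P) :
  (i0 < N)%N -> (j0 <= k - l)%N ->
  \sum_(i < N) \sum_(j < (k - l).+1)
    (if (i == i0 :> nat) && (j == j0 :> nat) then c else 0) *: G i j
  = c *: G i0 j0.
Proof.
move=> lt_i le_j; rewrite (bigD1 (Ordinal lt_i)) //= eqxx [X in _ + X]big1 ?addr0.
  rewrite (bigD1 (Ordinal (le_j : (j0 < (k - l).+1)%N))) //= eqxx big1 ?addr0 // => j.
  by rewrite -val_eqE /= => /negPf->; rewrite scale0r.
move=> i; rewrite -val_eqE /= => /negPf ne_i.
by rewrite big1 // => j _; rewrite ne_i scale0r.
Qed.

Lemma generator_CS (k l : nat) (Y : P -> P) (i j : nat) : (l <= k)%N ->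
  Y = @Sx m \/ Y = @Su m \/ Y = @Aop m \/ Y = @Cop m \/ Y = @Eulx m \/ Y = @Eulu m ->
  (j <= k - l)%N ->
  exists (N : nat) (c : nat -> nat -> CC), forall H : P, simpharm k l H ->
    Y (CS i j H) = \sum_(i' < N) \sum_(j' < (k - l).+1) c i' j' *: CS i' j' H.
Proof.
move=> le_lk hY le_j.
have single i0 j0 c : (j0 <= k - l)%N ->
    (forall H, hwv k l H -> Y (CS i j H) = c%:MP * CS i0 j0 H) ->
    exists (N : nat) (c : nat -> nat -> CC), forall H : P, simpharm k l H ->
      Y (CS i j H) = \sum_(i' < N) \sum_(j' < (k - l).+1) c i' j' *: CS i' j' H.
  move=> le_j0 YE; exists i0.+1, (fun i' j' => if (i' == i0) && (j' == j0) then c else 0).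
  move=> H /simpharmP/YE->.
  by rewrite (sum_single _ (fun i' j' => CS i' j' H)) // mul_mpolyC.
(* Where a generator gives 0 (S_x at j = 0, S_u at j = k - l, A at i = 0), an arbitrary index
   receives the coefficient 0. *)
case: hY single => [|[|[|[|[|]]]]] -> single.
- case: j le_j single => [|j] le_j single.
    by apply: (single 0 0%N 0) => // H hH; rewrite (Sx_CS0 hH) mul0r.
  by apply: (single i j); [exact: ltnW | move=> H hH; exact: (Sx_CS hH)].
- move: le_j; rewrite leq_eqVlt => /orP[/eqP e_j|lt_j].
    apply: (single 0%N 0%N 0) => // H hH.
    by rewrite (Su_CS hH) ?e_j // /CS (iterS_eq0 le_lk hH) // iterC0 mulr0 mul0r.
  by apply: (single i j.+1) => // H hH; apply: (Su_CS hH); exact: ltnW.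
- case: i single => [|i] single.
    apply: (single 0%N 0%N 0) => // H hH.
    by rewrite (AopE (wt_CS hH 0 le_j)) (A_CS0 hH) mul0r.
  by apply: (single i j) => // H hH; rewrite (AopE (wt_CS hH i.+1 le_j)) (A_CS hH).
- by apply: (single i.+1 j 1) => // H hH; rewrite mpolyC1 mul1r.
- apply: (single i j) => // H hH.
  by rewrite EulxE; case: (wt_CS hH i le_j) => _ _ -> _.
- apply: (single i j) => // H hH.
  by rewrite EuluE; case: (wt_CS hH i le_j) => _ _ _ ->.
Qed.

(** Pairing the vanishing sum with one of its terms t leaves <t, t> by orthogonality; so t = 0, and
    [CS_eq0] passes this on to the harmonic inside t. *)
Lemma CS_direct (K N : nat) (F : nat -> nat -> nat -> nat -> P) :
  (forall k l i j, (l <= k)%N -> simpharm k l (F k l i j)) ->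
  \sum_(k < K) \sum_(l < k.+1) \sum_(i < N) \sum_(j < (k - l).+1)
    CS i j (F k l i j) = 0 ->
  forall k l i j, (k < K)%N -> (l <= k)%N -> (i < N)%N -> (j <= k - l)%N ->
    F k l i j = 0.
Proof.
move=> hF sum0 k l i j lt_k le_l lt_i le_j.
have hH k' l' i' j' : (l' <= k')%N -> hwv k' l' (F k' l' i' j').
  by move=> le_l'; apply/simpharmP/hF.
apply: (CS_eq0 le_l (hH _ _ i j le_l) (i := i) le_j).
set t := CS i j _; apply: fischer_eq0.
have Z (k' l' i' j' : nat) : (l' < k'.+1)%N -> (j' < (k' - l').+1)%N ->
    (k', l', i', j') != (k, l, i, j) -> fischer (CS i' j' (F k' l' i' j')) t = 0.
  move=> le_l' le_j'.
  exact: (fischer_CS (hH k' l' i' j' le_l') (hH k l i j le_l) le_j' le_j).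
have := congr1 (fun f => fischer f t) sum0; rewrite fischer0l => <-.
rewrite fischer_suml (bigD1 (Ordinal lt_k)) //= [X in _ + X]big1 => [|k' ne_k]; last first.
  do 3![rewrite fischer_suml big1 // => ? _]; apply: Z => //.
  by rewrite -val_eqE /= in ne_k; rewrite !xpair_eqE (negPf ne_k).
rewrite addr0 fischer_suml (bigD1 (Ordinal (le_l : (l < k.+1)%N))) //=.
rewrite [X in _ + X]big1 => [|l' ne_l]; last first.
  do 2![rewrite fischer_suml big1 // => ? _]; apply: Z => //.
  by rewrite -val_eqE /= in ne_l; rewrite !xpair_eqE (negPf ne_l) !andbF.
rewrite addr0 fischer_suml (bigD1 (Ordinal lt_i)) //=.
rewrite [X in _ + X]big1 => [|i' ne_i]; last first.
  rewrite fischer_suml big1 // => ? _; apply: Z => //.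
  by rewrite -val_eqE /= in ne_i; rewrite !xpair_eqE (negPf ne_i) !andbF.
rewrite addr0 fischer_suml (bigD1 (Ordinal (le_j : (j < (k - l).+1)%N))) //=.
rewrite [X in _ + X]big1 ?addr0 // => j' ne_j; apply: Z => //.
by rewrite -val_eqE /= in ne_j; rewrite !xpair_eqE (negPf ne_j) !andbF.
Qed.

Lemma CS_injective (k l : nat) : (l <= k)%N ->
  forall (N : nat) (F : nat -> nat -> P), (forall i j, simpharm k l (F i j)) ->
  \sum_(i < N) \sum_(j < (k - l).+1) CS i j (F i j) = 0 ->
  forall i j, (i < N)%N -> (j <= k - l)%N -> F i j = 0.
Proof.
move=> le_lk N F hF sum0 i j lt_i le_j.
have hH i' j' : hwv k l (F i' j') by apply/simpharmP/hF.
apply: (CS_eq0 le_lk (hH i j) (i := i) le_j).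
set t := CS i j _; apply: fischer_eq0.
have Z (i' j' : nat) : (j' < (k - l).+1)%N -> (i' != i) || (j' != j) ->
    fischer (CS i' j' (F i' j')) t = 0.
  move=> le_j' ne; apply: (fischer_CS (hH i' j') (hH i j) le_j' le_j).
  by rewrite !xpair_eqE !eqxx /= negb_and.
have := congr1 (fun f => fischer f t) sum0; rewrite fischer0l => <-.
rewrite fischer_suml (bigD1 (Ordinal lt_i)) //= [X in _ + X]big1 => [|i' ne_i]; last first.
  rewrite fischer_suml big1 // => ? _; apply: Z => //.
  by rewrite -val_eqE /= in ne_i; rewrite ne_i.
rewrite addr0 fischer_suml (bigD1 (Ordinal (le_j : (j < (k - l).+1)%N))) //=.
rewrite [X in _ + X]big1 ?addr0 // => j' ne_j; apply: Z => //.
by rewrite -val_eqE /= in ne_j; rewrite ne_j orbT.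
Qed.

(** * Spanning *)

(** [n] bounds the power of C, with [n = 0] for ker A. The degree k - j + i in x is prescribed
    without subtraction. Closure under sums suffices, since a scalar can be absorbed into H. *)
Inductive CSspan (n p q : nat) : P -> Prop :=
| CSspan0 : CSspan n p q 0
| CSspanD f g : CSspan n p q f -> CSspan n p q g -> CSspan n p q (f + g)
| CSspan_gen k l i j H : hwv k l H -> (l <= k)%N -> (j <= k - l)%N -> (i <= n)%N ->
    (k + i = p + j)%N -> (l + j + i = q)%N -> CSspan n p q (CS i j H).

Lemma hwvC (k l : nat) c H : hwv k l H -> hwv k l (c%:MP * H).
Proof.
by move=> [wH AH SH]; split; [exact: wtC | rewrite D_C AH mulr0 | rewrite X_C SH mulr0].
Qed.

Lemma CS_C (k l i j : nat) c H : hwv k l H -> (j <= k - l)%N ->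
  CS i j (c%:MP * H) = c%:MP * CS i j H.
Proof.
move=> hH le_j; rewrite /CS.
have -> : iter j (@Su m) (c%:MP * H) = c%:MP * iter j (@Su m) H.
  elim: j {le_j} => [//|j IHj].
  by rewrite (iterSS (hwvC c hH)) (iterSS hH) IHj X_C.
have [wj _] := iterS_kerA hH j; apply: (iterC_C _ _ wj).
  by rewrite -natrB; [exact: deg1_nat | exact: leq_trans le_j (leq_subr _ _)].
by rewrite -natrD; exact: deg1_nat.
Qed.

Lemma CSspan_leq n n' p q f : (n <= n')%N -> CSspan n p q f -> CSspan n' p q f.
Proof.
move=> le_n; elim=> [|g h _ Hg _ Hh|k l i j H hH le_l le_j le_i]; first exact: CSspan0.
  exact: CSspanD.
by apply: CSspan_gen; rewrite ?(leq_trans le_i).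
Qed.

Lemma CSspan_wt n p q f : CSspan n p q f -> wt true p%:R q%:R f.
Proof.
elim=> [|g h _ Hg _ Hh|k l i j H hH le_l le_j le_i ep eq].
- exact: wt0.
- exact: wtD.
- have -> : p%:R = k%:R - j%:R + i%:R :> CC by rewrite addrAC -natrD ep natrD addrK.
  by rewrite -eq !natrD; exact: wt_CS.
Qed.

(** By [A_CS] and [Ccoef_neq0], one more C applied to a rescaled H gives a preimage. *)
Lemma A_preim n p q f : CSspan n p q f -> exists2 g, CSspan n.+1 p.+1 q.+1 g & A g = f.
Proof.
elim=> [|f1 f2 _ [g1 s1 e1] _ [g2 s2 e2]|k l i j H hH le_l le_j le_i ep eq].
- by exists 0; [exact: CSspan0 | rewrite raddf0].
- by exists (g1 + g2); [exact: CSspanD | rewrite raddfD /= e1 e2].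
set c := Ccoef (k%:R - j%:R) (l%:R + j%:R) k%:R l%:R i.+1.
have c0 : c != 0 by exact: Ccoef_neq0.
exists (CS i.+1 j (c^-1%:MP * H)).
  by apply: (CSspan_gen (hwvC _ hH)); rewrite // ?addnS ?addSn ?ep ?eq.
rewrite (CS_C _ _ hH) // D_C (A_CS hH) // mulrA -mpolyCM mulVf //.
by rewrite mpolyC1 mul1r.
Qed.

(* [f] need not be in the image of [<x,d_u>]: lowest weight vectors are left
   over as [h]. *)
Lemma Xdu_preim p q f : CSspan 0 p.+1 q f -> exists g h,
  [/\ CSspan 0 p q.+1 g, A g = 0, f = X true false g + h & X false true h = 0].
Proof.
elim=> [|f1 f2 _ [g1 [h1 [s1 a1 -> e1]]] _ [g2 [h2 [s2 a2 -> e2]]]|].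
- by exists 0, 0; rewrite !raddf0 addr0; split=> //; exact: CSspan0.
- exists (g1 + g2), (h1 + h2); rewrite !raddfD /= a1 a2 e1 e2 addr0 addrACA.
  by split=> //; exact: CSspanD.
move=> k l [|//] j H hH le_l le_j _; rewrite !addn0 => ep eq.
(* In the first case j = k - l: the end of the string is killed by <u, d_x> and is put into [h]. *)
have [le_j'|lt_j] := leqP (k - l) j.
  exists 0, (CS 0 j H); rewrite !raddf0 add0r; split=> //; first exact: CSspan0.
  by rewrite /CS /= -(iterSS hH) (iterS_eq0 le_l hH).
set c : CC := j.+1%:R * (k%:R - l%:R - j%:R).
have c0 : c != 0.
  rewrite mulf_neq0 ?pnatr_eq0 // -!natrB ?pnatr_eq0 ?subn_eq0 -?ltnNge //.
have hcH := hwvC c^-1 hH.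
exists (CS 0 j.+1 (c^-1%:MP * H)), 0; split.
- by apply: (CSspan_gen hcH); rewrite // ?addn0 ?addnS ?ep ?eq.
- exact: (A_CS0 hcH).
- rewrite addr0 /CS /= -iterS (Xdu_iterS hcH) -/c.
  have := @CS_C k l 0 j c^-1 H hH le_j; rewrite /CS /= => ->.
  by rewrite mulrA -mpolyCM mulfV // mpolyC1 mul1r.
- by rewrite raddf0.
Qed.

Lemma E_eigen_nat s a f : E s f = a%:MP * f -> (forall n : nat, a != n%:R) -> f = 0.
Proof.
move=> ef na; apply/mpolyP=> mo; rewrite mcoeff0.
have := congr1 (fun g : P => g@_mo) ef; rewrite mcoeff_E mcoeffCM => /eqP.
by rewrite -subr_eq0 -mulrBl mulf_eq0 subr_eq0 eq_sym (negPf (na _)) => /eqP.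
Qed.

Lemma opp1_nat n : -1 != n%:R :> CC.
Proof. by rewrite eq_sym -subr_eq0 opprK natr1 pnatr_eq0. Qed.

(** Induction on the degree in u, which <x, d_u> lowers. Subtracting a preimage [g] leaves [f'] in
    the kernel of <x, d_u>: a simplicial harmonic if its degree in u is at most that in x, and zero
    otherwise. *)
Lemma kerA_span (q p : nat) f : wt true p%:R q%:R f -> A f = 0 -> CSspan 0 p q f.
Proof.
elim: q p f => [|q IHq] p f wf Af.
  (* This polynomial would have degree -1 in u. *)
  have Sf : X true false f = 0.
    apply: (@E_eigen_nat false (-1)); last exact: opp1_nat.
    case: wf => _ _ _ /= e; rewrite (EN_S true) /= e mul0r raddf0 sub0r.
    by rewrite mpolyCN mpolyC1 mulN1r.
  by apply: (@CSspan_gen 0 p 0 p 0 0 0 f); rewrite // addn0.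
have wSf : wt true p.+1%:R q%:R (X true false f).
  have := wt_T wf (deg1_nat p); rewrite (TE wf (deg1_nat p)) /Sop Af !mulr0 subr0.
  by rewrite natr1 -[q.+1%:R]natr1 addrK.
have ASf : A (X true false f) = 0.
  by rewrite (A_S true) Af raddf0 add0r; case: wf.
have [g [h [sg Ag eh Sh]]] := Xdu_preim (IHq _ _ wSf ASf).
have wg := CSspan_wt sg; pose f' := f - g.
have wf' : wt true p%:R q.+1%:R f'.
  by rewrite /f' -[- g]mulN1r -mpolyC1 -mpolyCN; apply: wtD wf _; exact: wtC.
have Af' : A f' = 0 by rewrite raddfB /= Af Ag subr0.
have Sf' : X true false f' = h by rewrite raddfB /= eh addrC addKr.
(* [h] is both in the image of [<x,d_u>] and in the kernel of its adjoint. *)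
have h0 : h = 0.
  by apply: fischer_eq0; rewrite -{1}Sf' fischer_X Sh fischer0r.
rewrite {}h0 in Sf'.
have -> : f = f' + g by rewrite subrK.
apply: CSspanD => //.
have [le_q|lt_p] := leqP q.+1 p.
  by apply: (@CSspan_gen 0 p q.+1 p q.+1 0 0 f'); rewrite // ?addn0.
suff -> : f' = 0 by exact: CSspan0.
(* The bracket of the two lowering and raising operators gives the factor p - (q + 1), which is
   negative here; two nonnegative norms can be so related only if that of [f'] is 0. *)
have norm : fischer (X false true f') (X false true f') = (p%:R - q.+1%:R) * fischer f' f'.
  rewrite fischer_X (S_S true) /= Sf' raddf0 add0r.
  case: wf' => _ _ -> /= ->; rewrite -mulrBl -mpolyCB fischerCr.
  by rewrite rmorphB /= !conjC_nat.
apply: fischer_eq0; apply/eqP; rewrite eq_le fischer_ge0 andbT.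
have lt0 : p%:R - q.+1%:R < 0 :> CC by rewrite subr_lt0 ltr_nat.
by rewrite -(nmulr_rge0 _ lt0) -norm fischer_ge0.
Qed.

(** If p or q is 0, then A f would have degree -1 and vanishes. Otherwise induction puts A f in the
    span, and subtracting a lift through A leaves an element of ker A. *)
Lemma wt_span (p q : nat) f : wt true p%:R q%:R f -> CSspan p p q f.
Proof.
elim: p q f => [|p IHp] q f wf.
  apply: kerA_span => //; apply: (@E_eigen_nat true (-1)); last exact: opp1_nat.
  by case: (wt_A wf) => _ _; rewrite sub0r.
case: q wf => [|q] wf.
  apply: (@CSspan_leq 0) => //; apply: kerA_span => //.
  apply: (@E_eigen_nat false (-1)); last exact: opp1_nat.
  by case: (wt_A wf) => _ _ _; rewrite sub0r.
have wA : wt true p%:R q%:R (A f).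
  by have := wt_A wf; rewrite -![_.+1%:R]natr1 !addrK.
have [g sg eg] := A_preim (IHp _ _ wA).
rewrite -(subrK g f); apply: CSspanD => //.
apply: (@CSspan_leq 0) => //; apply: kerA_span; last by rewrite raddfB /= eg subrr.
rewrite -[- g]mulN1r -mpolyC1 -mpolyCN; apply: wtD wf _.
by apply: wtC; exact: CSspan_wt sg.
Qed.

Lemma Cop_D s a b f g : wt s a b f -> wt s a b g -> deg1 a -> deg1 b ->
  Cop (f + g) = Cop f + Cop g.
Proof.
move=> wf wg da db; rewrite (CopE wf) // (CopE wg) // (CopE (wtD wf wg)) //.
by rewrite /Cdef !raddfD /=; ring.
Qed.

Lemma hwvD (k l : nat) H H' : hwv k l H -> hwv k l H' -> hwv k l (H + H').
Proof.
move=> [wH AH SH] [wH' AH' SH'].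
by split; [exact: wtD | rewrite raddfD /= AH AH' addr0 | rewrite raddfD /= SH SH' addr0].
Qed.

Lemma hwv0 (k l : nat) : hwv k l (0 : P).
Proof. by split; rewrite ?raddf0 //; exact: wt0. Qed.

Lemma CS_D (k l i j : nat) H H' : hwv k l H -> hwv k l H' -> (j <= k - l)%N ->
  CS i j (H + H') = CS i j H + CS i j H'.
Proof.
move=> hH hH' le_j.
have SD n : iter n (@Su m) (H + H') = iter n (@Su m) H + iter n (@Su m) H'.
  elim: n => [//|n IHn].
  by rewrite (iterSS (hwvD hH hH')) (iterSS hH) (iterSS hH') IHn raddfD.
rewrite /CS SD; have [wj _] := iterS_kerA hH j; have [wj' _] := iterS_kerA hH' j.
have da : deg1 (k%:R - j%:R).
  by rewrite -natrB; [exact: deg1_nat | exact: leq_trans le_j (leq_subr _ _)].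
have db : deg1 (l%:R + j%:R) by rewrite -natrD; exact: deg1_nat.
elim: i => [//|i IHi]; rewrite !iterS IHi.
by apply: (Cop_D (wt_iterC i wj da db) (wt_iterC i wj' da db)); apply: deg1D.
Qed.

Lemma CS_0 (i j : nat) : CS i j (0 : P) = 0.
Proof. by rewrite /CS; elim: j => [|j IHj]; rewrite ?iterC0 // iterSr Su0. Qed.

(** * Bihomogeneous components and the full decomposition *)

Definition degs s (mo : 'X_{1..m + m}) := (\sum_(j < m) mo (idx s j))%N.

Definition bicomp p q f : P :=
  \sum_(mo <- msupp f | (degs true mo == p) && (degs false mo == q)) f@_mo *: 'X_[mo].

Lemma mcoeff_bicomp p q f mo : (bicomp p q f)@_mo =
  if (degs true mo == p) && (degs false mo == q) then f@_mo else 0.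
Proof.
rewrite /bicomp raddf_sum /= big_mkcond [in RHS](mpolyE f) raddf_sum /=.
case: ifP => c_mo; last (rewrite big1 // => mo' _);
  [apply: eq_bigr => mo' _|]; rewrite mcoeffZ mcoeffX;
  by have [->|_] := eqVneq mo' mo; rewrite ?c_mo ?mulr0 ?if_same.
Qed.

Lemma degsD s t (j : 'I_m) mo : degs t (mo + U_(idx s j)) = (degs t mo + (s == t))%N.
Proof.
rewrite /degs; under eq_bigr do rewrite mnmDE mnm1E idx_eq.
rewrite big_split; congr (_ + _)%N; rewrite (bigD1 j) //= eqxx andbT big1 ?addn0 // => i.
by rewrite eq_sym => /negPf->; rewrite andbF.
Qed.

Lemma D_bicomp s p q f : D s s f = 0 -> D s s (bicomp p q f) = 0.
Proof.
move=> Df; apply/mpolyP=> mo; rewrite mcoeff0.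
(* [c] says that [mo] raised by two in the vector s has bidegree (p, q): only coefficients at such
   raised monomials enter that of [D s s] at [mo]. *)
pose c := (degs true mo + (s == true) + (s == true) == p)%N
  && (degs false mo + (s == false) + (s == false) == q)%N.
transitivity (if c then (D s s f)@_mo else 0); last by rewrite Df mcoeff0 if_same.
rewrite !dotddE !raddf_sum /=.
have term (j : 'I_m) : (pd s j (pd s j (bicomp p q f)))@_mo =
    if c then (pd s j (pd s j f))@_mo else 0.
  rewrite /pd !mcoeff_mderiv mcoeff_bicomp !degsD -/c.
  by case: c; rewrite ?mul0rn.
by case: c term => term; [apply: eq_bigr | apply: big1] => j _; rewrite term.
Qed.

Lemma wt_bicomp p q f : dharm f -> wt true p%:R q%:R (bicomp p q f).
Proof.
move=> /dharmE[fx fu]; split; do ?exact: D_bicomp.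
- apply/mpolyP=> mo; rewrite mcoeff_E mcoeffCM mcoeff_bicomp.
  by case: andP => [[/eqP<- _]|]; rewrite ?mulr0.
- apply/mpolyP=> mo; rewrite mcoeff_E mcoeffCM mcoeff_bicomp.
  by case: andP => [[_ /eqP<-]|]; rewrite ?mulr0.
Qed.

Lemma bicomp_sum f : f = \sum_(p < msize f) \sum_(q < msize f) bicomp p q f.
Proof.
apply/mpolyP=> mo; rewrite raddf_sum /=.
have [mo_f|/memN_msupp_eq0 fmo] := boolP (mo \in msupp f); last first.
  rewrite fmo big1 // => p _; rewrite raddf_sum big1 // => q _ /=.
  by rewrite mcoeff_bicomp fmo if_same.
have deg_lt s : (degs s mo < msize f)%N.
  apply: leq_ltn_trans (msize_mdeg_lt mo_f); rewrite mdegE big_split_ord /= /degs.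
  by case: s; [exact: leq_addr | exact: leq_addl].
rewrite (bigD1 (Ordinal (deg_lt true))) //= [X in _ + X]big1 ?addr0 => [|p ne_p].
  rewrite raddf_sum (bigD1 (Ordinal (deg_lt false))) //= mcoeff_bicomp !eqxx.
  rewrite big1 ?addr0 // => q; rewrite -val_eqE /= eq_sym => /negPf ne_q.
  by rewrite mcoeff_bicomp ne_q andbF.
rewrite raddf_sum big1 // => q _; rewrite /= mcoeff_bicomp.
by move: ne_p; rewrite -val_eqE /= eq_sym => /negPf->.
Qed.

(* The bound [B] is only required to be large enough, so that two
   decompositions can be added. *)
Definition decomposed f := exists (B : nat) (F : nat -> nat -> nat -> nat -> P),
  (forall k l i j, hwv k l (F k l i j)) /\
  forall K N, (B <= K)%N -> (B <= N)%N ->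
    f = \sum_(k < K) \sum_(l < k.+1) \sum_(i < N) \sum_(j < (k - l).+1)
          CS i j (F k l i j).

Lemma decomposed0 : decomposed 0.
Proof.
exists 0%N, (fun _ _ _ _ => 0); split=> [*|K N _ _]; first exact: hwv0.
by do 4![rewrite big1 // => ? _]; rewrite CS_0.
Qed.

Lemma decomposedD f g : decomposed f -> decomposed g -> decomposed (f + g).
Proof.
move=> [B [F [hF eF]]] [B' [F' [hF' eF']]].
exists (maxn B B'), (fun k l i j => F k l i j + F' k l i j).
split=> [k l i j|K N]; first exact: hwvD.
rewrite !geq_max => /andP[leK leK'] /andP[leN leN'].
rewrite (eF K N) // (eF' K N) //; do 4![rewrite -big_split; apply: eq_bigr => ? _ /=].
by symmetry; apply: CS_D (hF _ _ _ _) (hF' _ _ _ _) _; rewrite -ltnS.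
Qed.

Lemma decomposed_CS (k l i j : nat) H : hwv k l H -> (l <= k)%N -> (j <= k - l)%N ->
  decomposed (CS i j H).
Proof.
move=> hH le_l le_j.
exists (maxn k.+1 i.+1),
  (fun k' l' i' j' => if [&& k' == k, l' == l, i' == i & j' == j] then H else 0).
split=> [k' l' i' j'|K N].
  by case: ifP => [/and4P[/eqP-> /eqP-> _ _] //|_]; exact: hwv0.
rewrite !geq_max => /andP[lt_k _] /andP[_ lt_i].
rewrite (bigD1 (Ordinal lt_k)) //= [X in _ + X]big1 => [|k' ne_k]; last first.
  do 3![rewrite big1 // => ? _].
  by rewrite -val_eqE /= in ne_k; rewrite (negPf ne_k) CS_0.
rewrite addr0 (bigD1 (Ordinal (le_l : (l < k.+1)%N))) //=.
rewrite [X in _ + X]big1 => [|l' ne_l]; last first.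
  do 2![rewrite big1 // => ? _].
  by rewrite -val_eqE /= in ne_l; rewrite (negPf ne_l) andbF CS_0.
rewrite addr0 (bigD1 (Ordinal lt_i)) //= [X in _ + X]big1 => [|i' ne_i]; last first.
  by rewrite big1 // => ? _; rewrite -val_eqE /= in ne_i; rewrite (negPf ne_i) !andbF CS_0.
rewrite addr0 (bigD1 (Ordinal (le_j : (j < (k - l).+1)%N))) //= !eqxx /=.
rewrite [X in _ + X]big1 ?addr0 // => j' ne_j.
by rewrite -val_eqE /= in ne_j; rewrite (negPf ne_j) CS_0.
Qed.

Lemma dharm_decomposed f : dharm f -> decomposed f.
Proof.
move=> hf; rewrite [f]bicomp_sum.
do 2!apply: (big_ind _ decomposed0 decomposedD) => ? _.
elim: (wt_span (wt_bicomp _ _ hf)) => [|g h _ Hg _ Hh|k l i j H hH le_l le_j _ _ _].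
- exact: decomposed0.
- exact: decomposedD.
- exact: decomposed_CS hH le_l le_j.
Qed.

(** * Rotations *)

Section Rotation.
Variable g : 'M[RR]_m.
Hypothesis hg : SOm g.
Local Notation rho := (@rot m g).
Local Notation r j k := ((invmx g j k)%:C)%C.

Let gi_tr : invmx g = g^T.
Proof.
case: hg => gtg _; have [_ ug] := mulmx1_unit gtg.
by rewrite -[LHS]mul1mx -gtg mulmxK.
Qed.

Let sum_row (j k : 'I_m) : \sum_(i < m) r j i * r k i = (j == k)%:R.
Proof.
have : (g^T *m g) j k = (j == k)%:R by case: hg => -> _; rewrite !mxE.
rewrite mxE => /(congr1 (fun z => (z%:C)%C)); rewrite rmorph_sum rmorph_nat /= => <-.
by apply: eq_bigr => i _; rewrite gi_tr !mxE rmorphM.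
Qed.

Let sum_col (j k : 'I_m) : \sum_(i < m) r i j * r i k = (j == k)%:R.
Proof.
have : (g *m g^T) j k = (j == k)%:R by case: hg => /mulmx1C-> _; rewrite !mxE.
rewrite mxE => /(congr1 (fun z => (z%:C)%C)); rewrite rmorph_sum rmorph_nat /= => <-.
by apply: eq_bigr => i _; rewrite gi_tr !mxE rmorphM.
Qed.

Lemma rhoE f : rho f = SOact g f.
Proof. by rewrite unlock. Qed.

Lemma rho_is_linear : linear rho.
Proof. by move=> c f h; rewrite !rhoE /SOact linearP. Qed.

HB.instance Definition _ := GRing.isLinear.Build CC P P *:%R rho rho_is_linear.

Lemma rhoD f h : rho (f + h) = rho f + rho h.
Proof. exact: linearD. Qed.

Lemma rhoB f h : rho (f - h) = rho f - rho h.
Proof. exact: linearB. Qed.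

Lemma rhoZ c f : rho (c *: f) = c *: rho f.
Proof. exact: linearZ. Qed.

Lemma rho_sum I (s : seq I) (F : I -> P) :
  rho (\sum_(i <- s) F i) = \sum_(i <- s) rho (F i).
Proof. exact: raddf_sum. Qed.

Lemma rhoM f h : rho (f * h) = rho f * rho h.
Proof. by rewrite !rhoE /SOact rmorphM. Qed.

Lemma rhoC c f : rho (c%:MP * f) = c%:MP * rho f.
Proof. by rewrite !mul_mpolyC rhoZ. Qed.

Lemma rho1 : rho 1 = 1.
Proof. by rewrite rhoE; exact: comp_mpoly1. Qed.

Lemma rho_var s (j : 'I_m) : rho (var s j) = \sum_(k < m) r j k *: var s k.
Proof.
rewrite rhoE /SOact /var comp_mpolyXU -tnth_nth tnth_mktuple.
by case: s => /=; rewrite ?(unsplitK (inl j)) ?(unsplitK (inr j)).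
Qed.

Lemma sum_scale_delta (a : 'I_m -> CC) (e : bool) (k : 'I_m) :
  \sum_(j < m) a j *: ((e && (j == k))%:R : P) = a k *: (e%:R : P).
Proof.
rewrite (bigD1 k) //= eqxx andbT big1 ?addr0 // => j /negPf->.
by rewrite andbF scaler0.
Qed.

(** The chain rule. The property [chain] is multiplicative and holds for 1 and the variables, hence
    for monomials, and then for all polynomials by linearity. *)
Lemma pd_rho s (j : 'I_m) f : pd s j (rho f) = \sum_(k < m) r k j *: rho (pd s k f).
Proof.
pose chain h := forall s (j : 'I_m), pd s j (rho h) = \sum_(k < m) r k j *: rho (pd s k h).
have chainM f1 f2 : chain f1 -> chain f2 -> chain (f1 * f2).
  move=> c1 c2 t i; rewrite rhoM pdM c1 c2 mulr_suml mulr_sumr -big_split.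
  by apply: eq_bigr => k _; rewrite /= pdM rhoD !rhoM scalerDr -scalerAl -scalerAr.
have chain1 : chain 1.
  move=> t i; have pd1 k : pd t k 1 = 0 by rewrite /pd -mpolyC1 mderivC.
  by rewrite rho1 pd1 big1 // => k _; rewrite pd1 linear0 scaler0.
have chain_var t k : chain (var t k).
  move=> s' i; rewrite rho_var raddf_sum.
  transitivity (\sum_(q < m) r k q *: (((s' == t) && (q == i))%:R : P)).
    by apply: eq_bigr => q _; rewrite /= pdZ pd_var [i == q]eq_sym.
  transitivity (\sum_(q < m) r q i *: (((s' == t) && (q == k))%:R : P)).
    by rewrite !sum_scale_delta.
  apply: eq_bigr => q _; rewrite pd_var.
  by case: (_ && _); rewrite ?rho1 ?linear0.
have chainX mo : chain 'X_[mo].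
  rewrite mpolyXE_id; apply: (big_ind chain chain1 chainM) => i _.
  have chain_i : chain 'X_i.
    by case: (split_ordP i) => q ->; [exact: (chain_var true) | exact: (chain_var false)].
  elim: (mo i) => [|n IHn]; first by rewrite expr0.
  by rewrite exprS; exact: chainM.
suff : chain f by exact.
rewrite [f]mpolyE; apply: big_ind => [t i|f1 f2 c1 c2 t i|mo _ t i].
- by rewrite !linear0 big1 // => k _; rewrite !linear0.
- rewrite rhoD pdD c1 c2 -big_split; apply: eq_bigr => k _ /=.
  by rewrite pdD rhoD scalerDr.
- rewrite rhoZ pdZ chainX scaler_sumr; apply: eq_bigr => k _.
  by rewrite pdZ rhoZ !scalerA mulrC.
Qed.

(** Two chain rules produce the Gram matrix of the rows of the inverse of g, which is the identity
    by orthogonality. *)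
Lemma D_rho s t f : D s t (rho f) = rho (D s t f).
Proof.
rewrite !dotddE rho_sum.
transitivity (\sum_(k < m) \sum_(q < m) (\sum_(j < m) r k j * r q j) *:
    rho (pd s q (pd t k f))).
  under eq_bigr => j _.
    rewrite pd_rho raddf_sum.
    under eq_bigr => k _ do rewrite /= pdZ pd_rho scaler_sumr.
    over.
  rewrite exchange_big; apply: eq_bigr => k _ /=.
  rewrite exchange_big; apply: eq_bigr => q _ /=.
  by rewrite scaler_suml; apply: eq_bigr => j _; rewrite scalerA.
apply: eq_bigr => k _; rewrite (bigD1 k) //= sum_row eqxx scale1r big1 ?addr0 // => q.
by rewrite sum_row eq_sym => /negPf->; rewrite scale0r.
Qed.

(** Summed against the variables, the coefficients of the chain rule reassemble into rotated
    variables. *)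
Lemma X_rho s t f : X s t (rho f) = rho (X s t f).
Proof.
rewrite !dotvdE rho_sum.
transitivity (\sum_(j < m) \sum_(k < m) (r k j *: var s j) * rho (pd t k f)).
  apply: eq_bigr => j _; rewrite pd_rho mulr_sumr; apply: eq_bigr => k _.
  by rewrite -scalerAr scalerAl.
rewrite exchange_big; apply: eq_bigr => k _ /=.
by rewrite rhoM rho_var mulr_suml.
Qed.

Lemma rho_dotvv s t : rho (dotvv m s t) = dotvv m s t.
Proof.
rewrite dotvvE rho_sum.
transitivity (\sum_(k < m) \sum_(q < m) (\sum_(j < m) r j k * r j q) *:
    (var s k * var t q)).
  under eq_bigr => j _.
    rewrite rhoM !rho_var mulr_suml.
    under eq_bigr => k _ do rewrite mulr_sumr.
    over.
  rewrite exchange_big; apply: eq_bigr => k _ /=.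
  rewrite exchange_big; apply: eq_bigr => q _ /=.
  rewrite scaler_suml; apply: eq_bigr => j _.
  by rewrite -scalerAr -scalerAl scalerA mulrC.
apply: eq_bigr => k _; rewrite (bigD1 k) //= sum_col eqxx scale1r big1 ?addr0 // => q.
by rewrite sum_col eq_sym => /negPf->; rewrite scale0r.
Qed.

Lemma wt_rho s a b f : wt s a b f -> wt s a b (rho f).
Proof.
move=> [f1 f2 f3 f4]; split; rewrite ?D_rho ?X_rho.
- by rewrite f1 linear0.
- by rewrite f2 linear0.
- by rewrite f3 rhoC.
- by rewrite f4 rhoC.
Qed.

Lemma hwv_rho (k l : nat) H : hwv k l H -> hwv k l (rho H).
Proof.
move=> [wH AH SH]; split; first exact: wt_rho.
  by rewrite D_rho AH linear0.
by rewrite X_rho SH linear0.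
Qed.

(** [Cop] is given by a choice, so the explicit [Cdef] is used: it is built from invariant scalar
    products and from operators that commute with the rotation. *)
Lemma Cop_rho s a b f : wt s a b f -> deg1 a -> deg1 b -> Cop (rho f) = rho (Cop f).
Proof.
move=> wf da db; rewrite (CopE wf) // (CopE (wt_rho wf)) //.
by rewrite /Cdef rhoD !rhoB !rhoC !rhoM !rho_dotvv -!X_rho -!D_rho.
Qed.

Lemma CS_rho (k l i j : nat) H : (l <= k)%N -> hwv k l H ->
  CS i j (rho H) = rho (CS i j H).
Proof.
move=> le_l hH; have hH' := hwv_rho hH; rewrite /CS.
have -> n : iter n (@Su m) (rho H) = rho (iter n (@Su m) H).
  by elim: n => [//|n IHn]; rewrite (iterSS hH) (iterSS hH') IHn X_rho.
(* Past the end of the string, j > k - l, both sides vanish. *)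
have [le_j|lt_j] := leqP j (k - l); last first.
  by rewrite (iterS_eq0 le_l hH) // linear0 iterC0 linear0.
have [wj _] := iterS_kerA hH j.
have da : deg1 (k%:R - j%:R).
  by rewrite -natrB; [exact: deg1_nat | exact: leq_trans le_j (leq_subr _ _)].
have db : deg1 (l%:R + j%:R) by rewrite -natrD; exact: deg1_nat.
elim: i => [//|i IHi]; rewrite !iterS IHi.
by apply: (Cop_rho (wt_iterC i wj da db)); apply: deg1D.
Qed.

End Rotation.

End Transvector.

Unset Implicit Arguments.

Theorem theorem4p1 (m : nat) (hm : (4 < m)%N) :
  (* (a) Z(g,s)-intertwining: every generator (S_x, S_u, A, C, and the Euler
     operators E_x, E_u) acts on the basis C^i S_u^j of V[k,l] with
     coefficients independent of the simplicial harmonic it is applied to *)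
  (forall (k l : nat), (l <= k)%N ->
   forall X : Pol m -> Pol m,
     X = Sx (m:=m) \/ X = Su (m:=m) \/ X = Aop (m:=m) \/ X = Cop (m:=m) \/
     X = Eulx (m:=m) \/ X = Eulu (m:=m) ->
   forall i j : nat, (j <= k - l)%N ->
   exists (N : nat) (c : nat -> nat -> CC),
     forall H : Pol m, simpharm k l H ->
       X (CS i j H) = \sum_(i' < N) \sum_(j' < (k - l).+1) c i' j' *: CS i' j' H) /\
  (* (b) SO(m)-intertwining *)
  (forall g : 'M[RR]_m, SOm g ->
   forall (k l : nat) (H : Pol m), (l <= k)%N -> simpharm k l H ->
     simpharm k l (SOact g H) /\
     forall i j : nat, CS i j (SOact g H) = SOact g (CS i j H)) /\
  (* (c) injectivity of V[k,l] (x) H_{k,l} -> double harmonics *)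
  (forall (k l : nat), (l <= k)%N ->
   forall (N : nat) (F : nat -> nat -> Pol m),
     (forall i j, simpharm k l (F i j)) ->
     \sum_(i < N) \sum_(j < (k - l).+1) CS i j (F i j) = 0 ->
     forall i j, (i < N)%N -> (j <= k - l)%N -> F i j = 0) /\
  (* (d) the images span all double harmonics ... *)
  (forall f : Pol m, dharm f ->
   exists (K N : nat) (F : nat -> nat -> nat -> nat -> Pol m),
     (forall k l i j, (l <= k)%N -> simpharm k l (F k l i j)) /\
     f = \sum_(k < K) \sum_(l < k.+1) \sum_(i < N) \sum_(j < (k - l).+1)
           CS i j (F k l i j)) /\
  (* (e) ... and their sum is direct *)
  (forall (K N : nat) (F : nat -> nat -> nat -> nat -> Pol m),
     (forall k l i j, (l <= k)%N -> simpharm k l (F k l i j)) ->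
     \sum_(k < K) \sum_(l < k.+1) \sum_(i < N) \sum_(j < (k - l).+1)
           CS i j (F k l i j) = 0 ->
     forall k l i j, (k < K)%N -> (l <= k)%N -> (i < N)%N -> (j <= k - l)%N ->
       F k l i j = 0).
Proof.
split; [|split; [|split; [|split]]].
- by move=> k l le_lk Y hY i j le_j; exact: generator_CS.
- move=> g hg k l H le_lk /simpharmP hH; rewrite -(rhoE g).
  split; first by apply/simpharmP; exact: hwv_rho.
  by move=> i j; rewrite -rhoE; exact: CS_rho hH.
- exact: CS_injective.
- move=> f hf; have [B [F [hF eF]]] := dharm_decomposed hm hf.
  by exists B, B, F; split; [move=> *; exact/simpharmP | exact: eF].
- exact: CS_direct.
Qed.
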